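(* Let $(N^5;E,F)$ be a Legendrian contact (LC) structure, $\{\mathbf e_1,\mathbf e_2,\mathbf f_1,\mathbf f_2\}$ an LC-adapted framing of $C=E\oplus F$ on $N$, and $\{\mathbf e^1,\mathbf e^2,\mathbf f^1,\mathbf f^2\}$ its dual coframing. Regard $\mathbf e_i,\mathbf f_i$ also as vector fields on the lift $\widetilde N$ (with local fibre coordinate $t$), so that $D=\langle\mathbf e_1+t\mathbf e_2,\;t\mathbf f_1-\mathbf f_2,\;\partial_t\rangle$. (1) The canonical line fields $V,L_1,L_2$ of the Borel geometry $(\widetilde N,D)$ are respectively spanned by $$\partial_t,\qquad \ell_1=\mathbf e_1+t\mathbf e_2+A_1\partial_t,\qquad \ell_2=t\mathbf f_1-\mathbf f_2+A_2\partial_t,$$ where, defining $\mathbf S:=[\mathbf e_1+t\mathbf e_2,\;t\mathbf f_1-\mathbf f_2]$, $$A_1=-(\mathbf f^1+t\mathbf f^2)(\mathbf S),\qquad A_2=(\mathbf e^2-t\mathbf e^1)(\mathbf S).$$ (2) Defining $\mathcal Q_4:=-dt(\Phi(\ell_1,\ell_2))$ in terms of the fundamental tensor $\Phi$, we have $$\mathcal Q_4=-\ell_1(A_2)+\ell_2(A_1)-\mathbf e^1(\mathbf S)\mathbf f^1(\mathbf S)-\mathbf e^2(\mathbf S)\mathbf f^2(\mathbf S),$$ which is a polynomial in $t$ of degree at most $4$.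
   Context: All objects are complex (holomorphic). An LC structure $(N^5;E,F)$ is a complex contact $5$-manifold $(N,C)$ with a splitting $C=E\oplus F$ into rank $2$ subdistributions that are isotropic for $\eta:\bigwedge^2C\to TN/C$, $X\wedge Y\mapsto[X,Y]\bmod C$. An LC-adapted framing is a local framing of $C$ with $E=\langle\mathbf e_1,\mathbf e_2\rangle$, $F=\langle\mathbf f_1,\mathbf f_2\rangle$ and, modulo $C$, $[\mathbf e_1,\mathbf e_2]\equiv[\mathbf e_1,\mathbf f_2]\equiv[\mathbf e_2,\mathbf f_1]\equiv[\mathbf f_1,\mathbf f_2]\equiv0$, $[\mathbf e_1,\mathbf f_1]\equiv[\mathbf e_2,\mathbf f_2]\not\equiv0$. Lift: $\widetilde N\to N$ (projection $\pi$) is the $\mathbb{P}^1$-bundle with fibre $\{(\ell_E,\ell_F)\in\mathbb{P}(E_x)\times\mathbb{P}(F_x):\eta(\ell_E,\ell_F)=0\}$. An LC-adapted framing trivializes it by $\ell_E=\langle s\mathbf e_1+t\mathbf e_2\rangle$, $\ell_F=\langle t\mathbf f_1-s\mathbf f_2\rangle$, with $[s:t]\in\mathbb{P}^1$; one works in the chart $s=1$. Vector fields on $N$ are extended to $N\times\mathbb{P}^1$ with trivial component on $\mathbb{P}^1$. The distribution $D$ on $\widetilde N$ is $D|_{(\ell_E,\ell_F)}=(\pi_* )^{-1}(\ell_E\oplus\ell_F)$; put $D^{-2}=[D,D]=\widetilde C:=(\pi_* )^{-1}C$, of rank $5$. (The field $\mathbf S$ takes values in the span of the $\mathbf e_i,\mathbf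 f_i$, so the dual coframing, extended to annihilate $\partial_t$, can be evaluated on it.) Canonical objects: $V\subset D$ is the line field of $X\in\Gamma(D)$ with $[X,\Gamma(D^{-2})]\subset\Gamma(D^{-2})$. $\sqrt D\subset D$ is the canonical rank $2$ subdistribution satisfying $[\sqrt D,\sqrt D]\equiv0\bmod D$; one has $D=V\oplus\sqrt D$. The Lie bracket induces an isomorphism $V\otimes\sqrt D\cong D^{-2}/D$ and a map $\sqrt D\otimes(D^{-2}/D)\to T\widetilde N/D^{-2}$, whose composition is a non-degenerate conformal symmetric bilinear form $\sqrt D\otimes\sqrt D\to V^*\otimes(T\widetilde N/D^{-2})$. $L_1,L_2$ are its two null lines, $\sqrt D=L_1\oplus L_2$ (canonical up to ordering). The fundamental tensor $\Phi:L_1\otimes L_2\to V$ is $\Phi(X,Y)=\operatorname{proj}_V([X,Y])$, using the projection $D=V\oplus\sqrt D\to V$. *)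

(* Defs.v *)
From HB Require Import structures.
From mathcomp Require Import all_boot all_order all_algebra complex.
From mathcomp Require Import all_classical all_reals all_analysis.

Set Implicit Arguments.
Unset Strict Implicit.
Unset Printing Implicit Defensive.

Import Order.TTheory GRing.Theory Num.Theory.
Import numFieldNormedType.Exports.

Local Open Scope classical_set_scope.
Local Open Scope ring_scope.

#[short(type="normedVectType")]
HB.structure Definition NormedVect (K : numFieldType) :=
  {V of NormedModule K V & Vector K V}.

HB.instance Definition _ (K : numFieldType) m n := Vector.on 'M[K]_(m, n).
HB.instance Definition _ (K : numFieldType) (V W : normedVectType K) :=
  Vector.on (V * W)%type.
HB.instance Definition _ (K : numFieldType) := Vector.on (Num.NumField.sort K).

(* R[i] seen as a numFieldType, so that it inherits the topology and the norm
   of the generic instances; everything below is derivation over K, hence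
   complex derivation for K = CC R. *)
Definition CC (R : realType) : numFieldType := R[i].

Section Local.
Context {K : numFieldType}.

Fixpoint diff_order {V W : normedModType K} (n : nat) (U : set V) (f : V -> W) :
    Prop :=
  (forall x, U x -> differentiable f x) /\
  (if n is m.+1 then forall v, diff_order m U (fun x => 'D_v f x) else True).

(* C^oo with K-linear differentials: for K = CC R this is "smooth and
   satisfying the Cauchy-Riemann equations". *)
Definition holomorphic {V W : normedModType K} (U : set V) (f : V -> W) : Prop :=
  forall n, diff_order n U f.

Definition lie {V : normedModType K} (X Y : V -> V) : V -> V :=
  fun x => 'D_(X x) Y x - 'D_(Y x) X x.

Context {V : normedVectType K}.
Implicit Types (U W : set V) (X Y : V -> V) (C D L Q : V -> {vspace V}).

Definition is_distribution U (r : nat) D : Prop :=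
  forall x, U x -> exists W (X : 'I_r -> V -> V),
    [/\ open W, W x, W `<=` U, forall j, holomorphic W (X j) &
        forall y, W y -> basis_of (D y) [tuple X j y | j < r]].

Definition tangent_to W D X : Prop := forall x, W x -> X x \in D x.

(* X \in \Gamma(W, D); all sections below are local ones, i.e. sections of the
   sheaf of holomorphic sections. *)
Definition holo_section W D X : Prop := holomorphic W X /\ tangent_to W D X.

(* \eta_x(u, v) = 0, where \eta(X /\ Y) = [X, Y] mod C for X, Y in C. *)
Definition levi_null U C (x : V) (u v : V) : Prop :=
  forall W X Y, open W -> W `<=` U -> W x ->
    holo_section W C X -> holo_section W C Y -> X x = u -> Y x = v ->
    lie X Y x \in C x.

Definition is_contact U C : Prop :=
  is_distribution U (\dim {:V}).-1 C /\
  forall x, U x -> forall u, u \in C x ->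
    (forall v, v \in C x -> levi_null U C x u v) -> u = 0.

(* The line field L of the X in \Gamma(D) with [X, \Gamma(D2)] in \Gamma(D2). *)
Definition is_characteristic U D D2 L : Prop :=
  [/\ is_distribution U 1 L,
      forall x, U x -> (L x <= D x)%VS &
      forall W X, open W -> W `<=` U -> holo_section W D X ->
        (tangent_to W L X <->
         forall W' Y, open W' -> W' `<=` W -> holo_section W' D2 Y ->
           tangent_to W' D2 (lie X Y))].

Definition is_sqrt U D Q : Prop :=
  [/\ is_distribution U 2 Q,
      forall x, U x -> (Q x <= D x)%VS &
      forall W X Y, open W -> W `<=` U -> holo_section W Q X ->
        holo_section W Q Y -> tangent_to W D (lie X Y)].

(* Representative, modulo D2, of the value on (v, X, Y) of the composition
   V (x) Q (x) Q -> Q (x) (D2 / D) -> TM / D2 of the maps induced by the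
   bracket: (v, X, Y) |-> [X, [v, Y]]. *)
Definition bracket_form (v X Y : V -> V) : V -> V := lie X (lie v Y).

Definition is_null_line U D2 (VV : V -> {vspace V}) Q L : Prop :=
  [/\ is_distribution U 1 L,
      forall x, U x -> (L x <= Q x)%VS &
      forall W (v X : V -> V), open W -> W `<=` U -> holo_section W VV v ->
        holo_section W L X -> tangent_to W D2 (bracket_form v X X)].

Record canonical_fields U D D2 (VV Q L1 L2 : V -> {vspace V}) : Prop := {
  canonical_V : is_characteristic U D D2 VV;
  canonical_sqrt : is_sqrt U D Q;
  canonical_L1 : is_null_line U D2 VV Q L1;
  canonical_L2 : is_null_line U D2 VV Q L2;
  canonical_split : forall x, U x -> Q x = (L1 x + L2 x)%VS }.

(* \Phi(X, Y) = proj_V [X, Y] for D = V (+) \sqrt D: daddv_pi A B is the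
   projection onto A along B. *)
Definition fundamental_tensor (VV Q : V -> {vspace V}) X Y : V -> V :=
  fun x => daddv_pi (VV x) (Q x) (lie X Y x).

End Local.

Section Manifold.

(* A manifold given by an atlas: chart i is the homeomorphism coord_map i from
   the open set chart_dom i of N onto an open subset of K^n, with inverse
   param i. *)
Record manifold (K : numFieldType) (n : nat) := Manifold {
  points :> topologicalType;
  chart_index : Type;
  chart_dom : chart_index -> set points;
  coord_map : chart_index -> points -> 'rV[K]_n;
  param : chart_index -> 'rV[K]_n -> points;
  _ : hausdorff_space points;
  _ : @second_countable points;
  _ : \bigcup_i chart_dom i = setT;
  _ : forall i, open (chart_dom i);
  _ : forall i, open (coord_map i @` chart_dom i);
  _ : forall i x, chart_dom i x -> param i (coord_map i x) = x;
  _ : forall i, {within chart_dom i, continuous (coord_map i)};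
  _ : forall i, {within coord_map i @` chart_dom i, continuous (param i)};
  _ : forall i j, holomorphic
        ((coord_map i @` chart_dom i) `&` (param i @^-1` chart_dom j))
        (coord_map j \o param i) }.

Context {K : numFieldType} {n : nat}.

Definition chart_img (N : manifold K n) (i : chart_index N) : set 'rV[K]_n :=
  coord_map i @` chart_dom i.

Definition overlap (N : manifold K n) (i j : chart_index N) : set 'rV[K]_n :=
  chart_img i `&` (param i @^-1` chart_dom j).

Definition transition (N : manifold K n) (i j : chart_index N) :
    'rV[K]_n -> 'rV[K]_n :=
  coord_map j \o param i.

(* Vector fields and distributions are given by their components in the
   charts, which are related by the differentials of the transition maps. *)
Record vector_field (N : manifold K n) := VectorField {
  vector_field_at :> chart_index N -> 'rV[K]_n -> 'rV[K]_n;
  _ : forall i, holomorphic (chart_img i) (vector_field_at i);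
  _ : forall i j x, overlap i j x ->
        vector_field_at j (transition i j x) =
        'D_(vector_field_at i x) (transition i j) x }.

Record distribution (N : manifold K n) (r : nat) := Distribution {
  distribution_at :> chart_index N -> 'rV[K]_n -> {vspace 'rV[K]_n};
  _ : forall i, is_distribution (chart_img i) r (distribution_at i);
  _ : forall i j x v, overlap i j x -> v \in distribution_at i x ->
        'D_v (transition i j) x \in distribution_at j (transition i j x) }.

End Manifold.

Section LegendrianContact.
Context {K : numFieldType}.

(* C = E + F; the sum is direct since C has rank 4. *)
Record LC_structure (N : manifold K 5) := LCStructure {
  LC_E : distribution N 2;
  LC_F : distribution N 2;
  LC_C := (fun i x => LC_E i x + LC_F i x)%VS;
  _ : forall i, is_contact (chart_img i) (LC_C i);
  _ : forall i x, chart_img i x -> forall u v, u \in LC_E i x ->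
        v \in LC_E i x -> levi_null (chart_img i) (LC_C i) x u v;
  _ : forall i x, chart_img i x -> forall u v, u \in LC_F i x ->
        v \in LC_F i x -> levi_null (chart_img i) (LC_C i) x u v }.

Definition LC_adapted (N : manifold K 5) (S : LC_structure N)
    (e1 e2 f1 f2 : vector_field N) : Prop :=
  forall i x, chart_img i x ->
    let C := LC_C S i x in
    [/\ LC_E S i x = <<[:: e1 i x; e2 i x]>>%VS /\
        LC_F S i x = <<[:: f1 i x; f2 i x]>>%VS,
        lie (e1 i) (e2 i) x \in C /\ lie (f1 i) (f2 i) x \in C,
        lie (e1 i) (f2 i) x \in C /\ lie (e2 i) (f1 i) x \in C,
        lie (e1 i) (f1 i) x - lie (e2 i) (f2 i) x \in C &
        lie (e1 i) (f1 i) x \notin C].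

End LegendrianContact.

(* In a chart U of N (a subset of V), the part s = 1 of the lift is U x K, with
   points p = (x, t). *)
Section Lift.
Context {K : numFieldType} {V : normedVectType K}.
Variables (U : set V) (E F : V -> {vspace V}).

(* The points of the lift over x. *)
Definition lift_fibre (x : V) (lE lF : {vspace V}) : Prop :=
  [/\ \dim lE = 1%N, \dim lF = 1%N, (lE <= E x)%VS, (lF <= F x)%VS &
      forall u v, u \in lE -> v \in lF ->
        levi_null U (fun y => E y + F y)%VS x u v].

Definition lift_dom : set (V * K) := [set p | U p.1].

Definition lift_field (X : V -> V) : V * K -> V * K := fun p => (X p.1, 0).

Definition ddt : V * K -> V * K := fun=> (0, 1).

Definition dt (w : V * K) : K := w.2.

(* Preimage of A under the differential of the projection \pi. *)
Definition pull_back (A : {vspace V}) : {vspace V * K} :=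
  (linfun (@fst V K) @^-1: A)%VS.

Variables (e1 e2 f1 f2 : V -> V).

Definition line_E (p : V * K) : {vspace V} := <[e1 p.1 + p.2 *: e2 p.1]>%VS.
Definition line_F (p : V * K) : {vspace V} := <[p.2 *: f1 p.1 - f2 p.1]>%VS.

Definition lift_D (p : V * K) : {vspace V * K} := pull_back (line_E p + line_F p)%VS.
Definition lift_D2 (p : V * K) : {vspace V * K} := pull_back (E p.1 + F p.1)%VS.

Definition field_E : V * K -> V * K :=
  fun p => lift_field e1 p + p.2 *: lift_field e2 p.
Definition field_F : V * K -> V * K :=
  fun p => p.2 *: lift_field f1 p - lift_field f2 p.
Definition field_S : V * K -> V * K := lie field_E field_F.

(* Coframing dual to (e1, e2, f1, f2), pulled back by \pi (so it annihilates
   ddt). It is only determined on C, and coord takes junk values off C. *)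
Definition coframe (j : 'I_4) (p w : V * K) : K :=
  coord [tuple e1 p.1; e2 p.1; f1 p.1; f2 p.1] j w.1.

Definition e1_S (p : V * K) : K := coframe (inord 0) p (field_S p).
Definition e2_S (p : V * K) : K := coframe (inord 1) p (field_S p).
Definition f1_S (p : V * K) : K := coframe (inord 2) p (field_S p).
Definition f2_S (p : V * K) : K := coframe (inord 3) p (field_S p).

Definition A1 (p : V * K) : K := - (f1_S p + p.2 * f2_S p).
Definition A2 (p : V * K) : K := e2_S p - p.2 * e1_S p.

Definition ell1 : V * K -> V * K := fun p => field_E p + A1 p *: ddt p.
Definition ell2 : V * K -> V * K := fun p => field_F p + A2 p *: ddt p.

(* VV and Q are the canonical fields V and \sqrt D. *)
Definition quartic (VV Q : V * K -> {vspace V * K}) (p : V * K) : K :=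
  - dt (fundamental_tensor VV Q ell1 ell2 p).

End Lift.

(* Main.v *)
(* Let th be a 1-form with kernel C, and let a1, a2, b1, b2, th be the coframe
   dual to e1, e2, f1, f2, [e1, f1].  If a form c vanishes on the fields X and
   Y, then c([X, Y]) = -dc(X, Y) depends only on the values of X and Y, so every
   bracket condition that defines V, sqrt D, L1 and L2 becomes pointwise linear
   algebra with the 2-forms dth, dal and dbe, where th, al = a2 - t a1 and
   be = b1 + t b2 generate the annihilator of D.  V is the line of D in the radical of
   dth on D2; dal = dbe = 0 on a plane of D forces it to be spanned by l1 and
   l2; and [X, [d_t, X]] = 2 x y mod D2 for X = x l1 + y l2 gives the
   null lines.  The formula for Q4 is the bracket [l1, l2] expanded in the frame.
   On a fibre the components of S are quadratic in t, so A1 and A2 are cubic,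
   and the terms of degree 5 of A2 d_t A1 - A1 d_t A2 cancel. *)
Require Import Defs.
From HB Require Import structures.
From mathcomp Require Import all_boot all_order all_algebra complex.
From mathcomp Require Import all_classical all_reals all_analysis.
From mathcomp Require Import ring zify.

Set Implicit Arguments.
Unset Strict Implicit.
Unset Printing Implicit Defensive.

Import Order.TTheory GRing.Theory Num.Theory.
Import numFieldNormedType.Exports.

Local Open Scope classical_set_scope.
Local Open Scope ring_scope.

(** * Differentials *)

Section Differentials.
Context {K : numFieldType}.
Implicit Types P W A B : normedModType K.

(** The canonical fields are specified by conditions on all local holomorphic sections, not by
    formulas. Existence therefore needs tensoriality, to pass from arbitrary sections to their
    values at a point. Uniqueness needs the reverse: an unknown distribution must supply a
    holomorphic local frame on which its own condition is tested. Both rest on forms that vanish on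
    the sections and can be differentiated, so the coframe has to be holomorphic and not merely dual
    at each point; cofactors of the frame matrix give this. The vector [[e1, f1]] completes the
    frame because it is transversal to C, and giving [th] the value 1 on it makes [-dth] on C equal
    to [e^1 /\ f^1 + e^2 /\ f^2], with constant coefficients. The forms [th], [al], [be] have no
    [dt] part, so only base components of fields on the lift are ever paired. The double bracket
    [[X, [v, X]]] differentiates [[v, X]], so brackets of holomorphic fields must be shown
    holomorphic. *)

Lemma near_eq_differentiable P W (f g : P -> W) (x : P) :
  (\forall y \near x, f y = g y) -> differentiable f x -> differentiable g x.
Proof.
move=> fg /diff_locallyxP[dfc dfE].
have fgx : f x = g x := nbhs_singleton fg.
have E : g \o shift x = cst (g x) + 'd f x +o_ 0 id.
  apply/eqaddoP => _/posnumP[e].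
  have /eqaddoP/(_ _ (gt0 e)) H := diff_locally (iffRL (diff_locallyxP _ _) (conj dfc dfE)).
  move: fg; rewrite (near_shift 0) subr0 => fg.
  by apply: filterS2 fg H => h /= fgh; rewrite !fctE /= fgh -fgx.
have dE := diff_unique dfc E.
by apply/diff_locallyP; rewrite dE.
Qed.

Lemma linear_comp_differentiable P A B (L : {linear A -> B}) (f : P -> A) x :
  continuous L -> differentiable f x -> differentiable (fun y => L (f y)) x.
Proof.
by move=> Lc df; apply: differentiable_comp => //; apply: linear_differentiable.
Qed.

Lemma derive_linear_comp P A B (L : {linear A -> B}) (f : P -> A) x v :
  continuous L -> differentiable f x ->
  'D_v (fun y => L (f y)) x = L ('D_v f x).
Proof.
move=> Lc df; have dL y : differentiable L y by apply: linear_differentiable.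
rewrite deriveE ?(diff_comp df (dL _)) ?diff_lin //= ?deriveE //.
exact: differentiable_comp.
Qed.

Lemma linear_precomp_differentiable P A B (L : {linear P -> A}) (f : A -> B) x :
  continuous L -> differentiable f (L x) -> differentiable (fun y => f (L y)) x.
Proof.
by move=> Lc df; apply: differentiable_comp => //; apply: linear_differentiable.
Qed.

Lemma derive_linear_precomp P A B (L : {linear P -> A}) (f : A -> B) x v :
  continuous L -> differentiable f (L x) ->
  'D_v (fun y => f (L y)) x = 'D_(L v) f (L x).
Proof.
move=> Lc df; have dL : differentiable L x by apply: linear_differentiable.
by rewrite deriveE ?(diff_comp dL df) ?diff_lin //= ?deriveE //; exact: differentiable_comp.
Qed.

Lemma fst_continuous A B : continuous (@fst A B : A * B -> A).
Proof. by move=> p; exact: cvg_fst. Qed.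

Lemma snd_continuous A B : continuous (@snd A B : A * B -> B).
Proof. by move=> p; exact: cvg_snd. Qed.

Lemma deriveDdir P W (f : P -> W) x u v : differentiable f x ->
  'D_(u + v) f x = 'D_u f x + 'D_v f x.
Proof. by move=> df; rewrite !deriveE // linearD. Qed.

Lemma deriveZdir P W (f : P -> W) x k v : differentiable f x ->
  'D_(k *: v) f x = k *: 'D_v f x.
Proof. by move=> df; rewrite !deriveE // linearZ. Qed.

Lemma deriveNdir P W (f : P -> W) x v : differentiable f x ->
  'D_(- v) f x = - 'D_v f x.
Proof. by move=> df; rewrite !deriveE // linearN. Qed.

Lemma differentiable_rV P n (f : P -> 'rV[K]_n) x :
  (forall j, differentiable (fun y => f y 0 j : K) x) -> differentiable f x.
Proof.
move=> df.
have -> : f = \sum_(j < n) (fun y => f y 0 j *: ('e_j : 'rV[K]_n)).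
  apply/funext => y; rewrite fct_sumE; apply/rowP => k.
  by rewrite [in LHS](row_sum_delta (f y)).
apply: differentiable_sum => j; exact: differentiableZl.
Qed.

Lemma differentiable_entry P n (f : P -> 'rV[K]_n) x j :
  differentiable f x -> differentiable (fun y => f y 0 j : K) x.
Proof.
move=> df; apply: (differentiable_comp (g := fun N : 'rV[K]_n => N 0 j)) => //.
exact: differentiable_coord.
Qed.

Lemma derive_entry P n (f : P -> 'rV[K]_n) x v j :
  differentiable f x -> ('D_v f x) 0 j = 'D_v (fun y => f y 0 j : K) x.
Proof.
move=> df; pose L (u : 'rV[K]_n) : K := u 0 j.
have Ll : linear L by move=> k u w; rewrite /L !mxE.
pose LM := GRing.isLinear.Build _ _ _ _ L Ll.
pose LL : {linear 'rV[K]_n -> K} := HB.pack L LM.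
have Lc : continuous LL by exact: coord_continuous.
exact: esym (derive_linear_comp v Lc df).
Qed.

Lemma derive_fst P A B (f : P -> A * B) x v : differentiable f x ->
  ('D_v f x).1 = 'D_v (fun y => (f y).1) x.
Proof. by move=> df; rewrite (derive_linear_comp (L := fst)) //; exact: fst_continuous. Qed.

Lemma derive_snd P A B (f : P -> A * B) x v : differentiable f x ->
  ('D_v f x).2 = 'D_v (fun y => (f y).2) x.
Proof. by move=> df; rewrite (derive_linear_comp (L := snd)) //; exact: snd_continuous. Qed.

Lemma differentiable_fst P A B (f : P -> A * B) x : differentiable f x ->
  differentiable (fun y => (f y).1) x.
Proof. by apply: (linear_comp_differentiable (L := fst)); exact: fst_continuous. Qed.

End Differentials.

(** * Calculus of holomorphic maps *)

Section Pairing.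
Context {K : numFieldType} {n : nat}.
Implicit Types (P : normedModType K) (u c : 'rV[K]_n).

(** Covectors are stored as row vectors, so that a 1-form is a map into ['rV[K]_n] and the
    holomorphic calculus of vector fields applies to forms without change. *)
Definition pairing u c : K := \sum_k u 0 k * c 0 k.

Lemma pairingDl u (v : 'rV[K]_n) c : pairing (u + v) c = pairing u c + pairing v c.
Proof. by rewrite -big_split; apply: eq_bigr => k _ /=; rewrite mxE mulrDl. Qed.

Lemma pairingZl a u c : pairing (a *: u) c = a * pairing u c.
Proof. by rewrite big_distrr; apply: eq_bigr => k _ /=; rewrite mxE mulrA. Qed.

Lemma pairingC u c : pairing u c = pairing c u.
Proof. by apply: eq_bigr => k _; rewrite mulrC. Qed.

Lemma pairing0l c : pairing 0 c = 0.
Proof. by rewrite -(scale0r 0) pairingZl mul0r. Qed.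

Lemma pairingNl u c : pairing (- u) c = - pairing u c.
Proof. by rewrite -scaleN1r pairingZl mulN1r. Qed.

Lemma pairingDr u c d : pairing u (c + d) = pairing u c + pairing u d.
Proof. by rewrite pairingC pairingDl !(pairingC u). Qed.

Lemma pairingZr a u c : pairing u (a *: c) = a * pairing u c.
Proof. by rewrite pairingC pairingZl (pairingC u). Qed.

Lemma pairingNr u c : pairing u (- c) = - pairing u c.
Proof. by rewrite pairingC pairingNl (pairingC u). Qed.

Lemma pairing_comb a b u (v : 'rV[K]_n) c :
  pairing (a *: u + b *: v) c = a * pairing u c + b * pairing v c.
Proof. by rewrite pairingDl !pairingZl. Qed.

Lemma pairing0r c : pairing c 0 = 0.
Proof. by rewrite pairingC pairing0l. Qed.

Lemma derive_pairing P (f g : P -> 'rV[K]_n) x v :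
  differentiable f x -> differentiable g x ->
  'D_v (fun y => pairing (f y) (g y)) x =
  pairing ('D_v f x) (g x) + pairing (f x) ('D_v g x).
Proof.
move=> df dg.
rewrite (_ : (fun _ => _) = \sum_k ((fun y => f y 0 k) * (fun y => g y 0 k))); last first.
  by apply/funext => y; rewrite fct_sumE.
have H k (h : P -> 'rV[K]_n) : differentiable h x -> derivable (fun y => h y 0 k) x v.
  by move=> dh; apply: diff_derivable; exact: differentiable_entry.
rewrite derive_sum => [|k]; last by apply: derivableM; exact: H.
rewrite -big_split; apply: eq_bigr => k _ /=.
rewrite deriveM; [|exact: H|exact: H].
by rewrite !derive_entry // addrC; congr (_ + _); exact: mulrC.
Qed.

Lemma differentiable_scaler P (k : P -> K) (f : P -> 'rV[K]_n) x :
  differentiable k x -> differentiable f x -> differentiable (fun y => k y *: f y) x.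
Proof.
move=> dk df; apply: differentiable_rV => j.
rewrite (_ : (fun _ => _) = k * (fun y => f y 0 j)).
  by apply: differentiableM => //; exact: differentiable_entry.
by apply/funext => y; rewrite mxE.
Qed.

Lemma derive_scaler P (k : P -> K) (f : P -> 'rV[K]_n) x v :
  differentiable k x -> differentiable f x ->
  'D_v (fun y => k y *: f y) x = 'D_v k x *: f x + k x *: 'D_v f x.
Proof.
move=> dk df; apply/rowP => j; rewrite derive_entry; last exact: differentiable_scaler.
rewrite (_ : (fun y => (k y *: f y) 0 j) = k * (fun y => f y 0 j)); last first.
  by apply/funext => y; rewrite mxE.
rewrite deriveM; [|exact: diff_derivable|apply: diff_derivable; exact: differentiable_entry].
by rewrite !mxE !derive_entry // addrC; congr (_ + _); exact: mulrC.
Qed.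

End Pairing.

Section Holomorphic.
Context {K : numFieldType}.
Implicit Types P W A B : normedModType K.

Lemma diff_orderS P W m (U : set P) (f : P -> W) :
  diff_order m.+1 U f -> diff_order m U f.
Proof.
elim: m f => [|m IH] f [df Df]; first by split.
by split=> // v; apply: IH; exact: Df.
Qed.

(** A derivative at a point of an open set depends only on the germ. This lets each induction on the
    order replace ['D_v] of a compound map by the expression that the Leibniz or chain rule
    gives. *)
Lemma diff_order_eq P W m (U : set P) (f g : P -> W) : open U ->
  (forall x, U x -> f x = g x) -> diff_order m U f -> diff_order m U g.
Proof.
move=> oU; elim: m f g => [|m IH] f g fg [df Df].
  split=> // x Ux; apply: near_eq_differentiable (df x Ux).
  by apply: filterS (open_nbhs_nbhs (conj oU Ux)).
split=> [x Ux|v].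
  apply: near_eq_differentiable (df x Ux).
  by apply: filterS (open_nbhs_nbhs (conj oU Ux)).
apply: IH (Df v) => x Ux; apply: near_eq_derive.
by apply: filterS (open_nbhs_nbhs (conj oU Ux)).
Qed.

Lemma holomorphic_eq P W (U : set P) (f g : P -> W) : open U ->
  (forall x, U x -> f x = g x) -> holomorphic U f -> holomorphic U g.
Proof. by move=> oU fg hf m; apply: diff_order_eq (hf m). Qed.

Lemma holomorphic_subset P W (U U' : set P) (f : P -> W) : U' `<=` U ->
  holomorphic U f -> holomorphic U' f.
Proof.
move=> UU hf m; elim: m f {hf}(hf m) => [|m IH] f [df Df]; split=> //.
- by move=> x /UU /df.
- by move=> x /UU /df.
- by move=> v; exact: IH (Df v).
Qed.

Lemma holomorphic_differentiable P W (U : set P) (f : P -> W) x :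
  holomorphic U f -> U x -> differentiable f x.
Proof. by move=> /(_ 0%N)[df _]; exact: df. Qed.

Lemma holomorphic_derive P W (U : set P) (f : P -> W) v :
  holomorphic U f -> holomorphic U (fun x => 'D_v f x).
Proof. by move=> hf m; have [_] := hf m.+1; apply. Qed.

Lemma holomorphic_cst P W (U : set P) (a : W) : holomorphic U (fun=> a).
Proof.
move=> m; elim: m a => [|m IH] a.
  by split=> // x _; exact: differentiable_cst.
split=> [x _|v]; first exact: differentiable_cst.
have -> : (fun x => 'D_v (fun=> a) x) = (fun=> 0 : W) by apply/funext => x; exact: derive_cst.
exact: IH.
Qed.

Lemma diff_orderD P W m (U : set P) (f g : P -> W) : open U ->
  diff_order m U f -> diff_order m U g -> diff_order m U (fun x => f x + g x).
Proof.
move=> oU; elim: m f g => [|m IH] f g [df Df] [dg Dg]; split=> //.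
- by move=> x Ux; apply: differentiableD; [exact: df|exact: dg].
- by move=> x Ux; apply: differentiableD; [exact: df|exact: dg].
move=> v; apply: diff_order_eq (IH _ _ (Df v) (Dg v)) => // x Ux.
by symmetry; apply: (deriveD (f := f) (g := g)); apply: diff_derivable; [exact: df|exact: dg].
Qed.

Lemma diff_orderN P W m (U : set P) (f : P -> W) : open U ->
  diff_order m U f -> diff_order m U (fun x => - f x).
Proof.
move=> oU; elim: m f => [|m IH] f [df Df]; split=> //.
- by move=> x Ux; apply: differentiableN; exact: df.
- by move=> x Ux; apply: differentiableN; exact: df.
move=> v; apply: diff_order_eq (IH _ (Df v)) => // x Ux.
by symmetry; apply: (deriveN (f := f)); apply: diff_derivable; exact: df.
Qed.

Lemma diff_orderM P m (U : set P) (f g : P -> K) : open U ->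
  diff_order m U f -> diff_order m U g -> diff_order m U (fun x => f x * g x).
Proof.
move=> oU; elim: m f g => [|m IH] f g Hf Hg.
  have [df _] := Hf; have [dg _] := Hg.
  by split=> // x Ux; apply: differentiableM; [exact: df|exact: dg].
have [df Df] := Hf; have [dg Dg] := Hg; split=> [x Ux|v].
  by apply: differentiableM; [exact: df|exact: dg].
apply: (@diff_order_eq _ _ _ _ (fun x => f x * 'D_v g x + g x * 'D_v f x)) => //.
  by move=> x Ux; symmetry; apply: (deriveM (f := f) (g := g));
  apply: diff_derivable; [exact: df|exact: dg].
(* Leibniz multiplies an undifferentiated factor by a derivative of one order less, so [diff_orderS]
   lowers the former before the induction hypothesis applies. *)
apply: diff_orderD => //; apply: IH; first exact: diff_orderS.
- exact: Dg.
- exact: diff_orderS.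
- exact: Df.
Qed.

(** The derivative is [- f^-2 'D_v f], in which the inverse reappears at the lower order of the
    induction hypothesis. *)
Lemma diff_orderV P m (U : set P) (f : P -> K) : open U ->
  (forall x, U x -> f x != 0) ->
  diff_order m U f -> diff_order m U (fun x => (f x)^-1).
Proof.
move=> oU f0; elim: m => [|m IH] Hf.
  by have [df _] := Hf; split=> // x Ux; apply: differentiableV; [exact: df|exact: f0].
have [df Df] := Hf; split=> [x Ux|v].
  by apply: differentiableV; [exact: df|exact: f0].
have IHf := IH (diff_orderS Hf).
apply: (@diff_order_eq _ _ _ _ (fun x => - ((f x)^-1 * (f x)^-1 * 'D_v f x))) => //.
  move=> x Ux; rewrite (deriveV (f0 x Ux)); last by apply: diff_derivable; exact: df.
  by rewrite scaleNr -exprVn expr2.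
apply: diff_orderN => //; apply: diff_orderM; [by []| |exact: Df].
exact: diff_orderM.
Qed.

Lemma holomorphicD P W (U : set P) (f g : P -> W) : open U ->
  holomorphic U f -> holomorphic U g -> holomorphic U (fun x => f x + g x).
Proof. by move=> oU hf hg m; exact: diff_orderD. Qed.

Lemma holomorphicN P W (U : set P) (f : P -> W) : open U ->
  holomorphic U f -> holomorphic U (fun x => - f x).
Proof. by move=> oU hf m; exact: diff_orderN. Qed.

Lemma holomorphicB P W (U : set P) (f g : P -> W) : open U ->
  holomorphic U f -> holomorphic U g -> holomorphic U (fun x => f x - g x).
Proof. by move=> oU hf hg; apply: holomorphicD => //; exact: holomorphicN. Qed.

Lemma holomorphicM P (U : set P) (f g : P -> K) : open U ->
  holomorphic U f -> holomorphic U g -> holomorphic U (fun x => f x * g x).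
Proof. by move=> oU hf hg m; exact: diff_orderM. Qed.

Lemma holomorphicV P (U : set P) (f : P -> K) : open U ->
  (forall x, U x -> f x != 0) ->
  holomorphic U f -> holomorphic U (fun x => (f x)^-1).
Proof. by move=> oU f0 hf m; exact: diff_orderV. Qed.

Lemma holomorphic_sum P W (U : set P) (I : Type) (r : seq I) (p : pred I)
    (f : I -> P -> W) : open U ->
  (forall i, p i -> holomorphic U (f i)) ->
  holomorphic U (fun x => \sum_(i <- r | p i) f i x).
Proof.
move=> oU hf; elim: r => [|i r IH].
  by apply: (holomorphic_eq oU _ (holomorphic_cst U 0)) => x _; rewrite big_nil.
case: (boolP (p i)) => pi.
  apply: (@holomorphic_eq _ _ _ (fun x => f i x + \sum_(j <- r | p j) f j x)) => //.
    by move=> x _; rewrite big_cons pi.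
  by apply: holomorphicD => //; exact: hf.
by apply: holomorphic_eq IH => // x _; rewrite big_cons (negPf pi).
Qed.

Lemma holomorphic_prod P (U : set P) (I : Type) (r : seq I) (p : pred I)
    (f : I -> P -> K) : open U ->
  (forall i, p i -> holomorphic U (f i)) ->
  holomorphic U (fun x => \prod_(i <- r | p i) f i x).
Proof.
move=> oU hf; elim: r => [|i r IH].
  by apply: (holomorphic_eq oU _ (@holomorphic_cst P K U 1)) => x _; rewrite big_nil.
case: (boolP (p i)) => pi.
  apply: (@holomorphic_eq _ _ _ (fun x => f i x * \prod_(j <- r | p j) f j x)) => //.
    by move=> x _; rewrite big_cons pi.
  by apply: holomorphicM => //; exact: hf.
by apply: holomorphic_eq IH => // x _; rewrite big_cons (negPf pi).
Qed.

Lemma holomorphicX P (U : set P) (f : P -> K) m : open U ->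
  holomorphic U f -> holomorphic U (fun x => f x ^+ m).
Proof.
move=> oU hf; elim: m => [|m IH]; first exact: holomorphic_cst.
apply: (@holomorphic_eq _ _ _ (fun x => f x * f x ^+ m)) => //.
  by move=> x _; rewrite exprS.
exact: holomorphicM.
Qed.

Lemma holomorphic_linear_comp P A B (U : set P) (L : {linear A -> B})
    (f : P -> A) : open U -> continuous L ->
  holomorphic U f -> holomorphic U (fun x => L (f x)).
Proof.
move=> oU Lc hf m; elim: m f {hf}(hf m) => [|m IH] f [df Df]; split=> //.
- by move=> x /df; exact: linear_comp_differentiable.
- by move=> x /df; exact: linear_comp_differentiable.
move=> v; apply: diff_order_eq (IH _ (Df v)) => // x /df dfx.
by rewrite derive_linear_comp.
Qed.

Lemma holomorphic_linear_precomp P A B (U : set A) (L : {linear P -> A})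
    (f : A -> B) : open U -> continuous L ->
  holomorphic U f -> holomorphic (L @^-1` U) (fun x => f (L x)).
Proof.
move=> oU Lc hf; have oU' : open (L @^-1` U) by move/continuousP: Lc; apply.
move=> m; elim: m f {hf}(hf m) => [|m IH] f [df Df]; split=> //.
- by move=> x /df; exact: linear_precomp_differentiable.
- by move=> x /df; exact: linear_precomp_differentiable.
move=> v; apply: diff_order_eq (IH _ (Df (L v))) => // x /df dfx.
by rewrite derive_linear_precomp.
Qed.

Lemma holomorphic_rV P n (U : set P) (f : P -> 'rV[K]_n) : open U ->
  (forall j, holomorphic U (fun x => f x 0 j : K)) -> holomorphic U f.
Proof.
move=> oU hf m; have {}hf j := hf j m.
elim: m f hf => [|m IH] f hf; split=> //.
- by move=> x Ux; apply: differentiable_rV => j; have [df _] := hf j; exact: df.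
- by move=> x Ux; apply: differentiable_rV => j; have [df _] := hf j; exact: df.
move=> v; apply: IH => j; have [_ /(_ v)] := hf j.
apply: diff_order_eq => // x Ux; rewrite derive_entry //.
by apply: differentiable_rV => k; have [df _] := hf k; exact: df.
Qed.

Lemma holomorphic_entry P n (U : set P) (f : P -> 'rV[K]_n) j : open U ->
  holomorphic U f -> holomorphic U (fun x => f x 0 j : K).
Proof.
move=> oU hf m; elim: m f {hf}(hf m) => [|m IH] f [df Df]; split=> //.
- by move=> x /df; exact: differentiable_entry.
- by move=> x /df; exact: differentiable_entry.
move=> v; apply: diff_order_eq (IH _ (Df v)) => // x /df dfx.
by rewrite derive_entry.
Qed.

Lemma holomorphic_scaler P n (U : set P) (k : P -> K) (f : P -> 'rV[K]_n) :
  open U -> holomorphic U k -> holomorphic U f ->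
  holomorphic U (fun x => k x *: f x).
Proof.
move=> oU hk hf; apply: holomorphic_rV => // j.
apply: (@holomorphic_eq _ _ _ (fun x => k x * f x 0 j)) => //.
  by move=> x _; rewrite mxE.
by apply: holomorphicM => //; exact: holomorphic_entry.
Qed.

Lemma holomorphic_pairing P n (U : set P) (f g : P -> 'rV[K]_n) : open U ->
  holomorphic U f -> holomorphic U g ->
  holomorphic U (fun x => pairing (f x) (g x)).
Proof.
move=> oU hf hg; apply: holomorphic_sum => // k _.
by apply: holomorphicM => //; exact: holomorphic_entry.
Qed.

Lemma holomorphic_pair P A B (U : set P) (f : P -> A) (g : P -> B) : open U ->
  holomorphic U f -> holomorphic U g -> holomorphic U (fun x => (f x, g x)).
Proof.
move=> oU hf hg m; elim: m f g {hf hg}(hf m) (hg m) => [|m IH] f g [df Df] [dg Dg].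
  by split=> // x Ux; apply: differentiable_pair; [exact: df|exact: dg].
have dfg x : U x -> differentiable (fun x => (f x, g x)) x.
  by move=> Ux; apply: differentiable_pair; [exact: df|exact: dg].
split=> // v; apply: diff_order_eq (IH _ _ (Df v) (Dg v)) => // x Ux.
rewrite [RHS]surjective_pairing derive_fst ?derive_snd //; exact: dfg.
Qed.

Lemma holomorphic_fst P A B (U : set P) (f : P -> A * B) : open U ->
  holomorphic U f -> holomorphic U (fun x => (f x).1).
Proof. by move=> oU; apply: (holomorphic_linear_comp (L := fst)) => //; exact: fst_continuous. Qed.

Lemma holomorphic_snd P A B (U : set P) (f : P -> A * B) : open U ->
  holomorphic U f -> holomorphic U (fun x => (f x).2).
Proof. by move=> oU; apply: (holomorphic_linear_comp (L := snd)) => //; exact: snd_continuous. Qed.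

Lemma holomorphic_id P (U : set P) : open U -> holomorphic U id.
Proof.
move=> oU [|m]; split=> // v.
apply: diff_order_eq (holomorphic_cst U v m) => // x Ux.
by rewrite derive_id.
Qed.

(** [diff_order] iterates derivatives in fixed directions only, whereas a bracket differentiates
    along a direction that moves with the point. Expanding that direction in the standard basis
    gives fixed directions with holomorphic coefficients. *)
Lemma holomorphic_lie n (U : set 'rV[K]_n) (X Y : 'rV[K]_n -> 'rV[K]_n) : open U ->
  holomorphic U X -> holomorphic U Y -> holomorphic U (lie X Y).
Proof.
move=> oU.
suff H (Z Y' : 'rV[K]_n -> 'rV[K]_n) : holomorphic U Z -> holomorphic U Y' ->
    holomorphic U (fun x => 'D_(Z x) Y' x).
  by move=> hX hY; apply: holomorphicB => //; exact: H.
move=> hZ hY.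
apply: (@holomorphic_eq _ _ _ (fun x => \sum_k Z x 0 k *: 'D_('e_k) Y' x)) => //.
  move=> x Ux; have dY := holomorphic_differentiable hY Ux.
  rewrite [in RHS](row_sum_delta (Z x)) deriveE // linear_sum.
  by apply: eq_bigr => k _; rewrite linearZ deriveE.
apply: holomorphic_sum => // k _; apply: holomorphic_scaler => //.
  exact: holomorphic_entry.
exact: holomorphic_derive.
Qed.

Lemma holomorphic_det P n (U : set P) (M : P -> 'M[K]_n) : open U ->
  (forall i j, holomorphic U (fun x => M x i j)) -> holomorphic U (fun x => \det (M x)).
Proof.
move=> oU hM; apply: holomorphic_sum => // s _; apply: holomorphicM => //.
  exact: holomorphic_cst.
exact: holomorphic_prod.
Qed.

(** Each entry is a cofactor divided by the determinant. Invertibility serves the formula as well as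
    the division, since [invmx] returns a singular matrix unchanged. *)
Lemma holomorphic_invmx P n (U : set P) (M : P -> 'M[K]_n) i j : open U ->
  (forall x, U x -> M x \in unitmx) ->
  (forall i j, holomorphic U (fun x => M x i j)) ->
  holomorphic U (fun x => invmx (M x) i j).
Proof.
move=> oU Mu hM.
apply: (@holomorphic_eq _ _ _ (fun x => (\det (M x))^-1 *
    ((-1) ^+ (j + i) * \det (row' j (col' i (M x)))))) => //.
  by move=> x Ux; rewrite /invmx Mu // !mxE.
apply: holomorphicM => //.
  apply: holomorphicV => //; last exact: holomorphic_det.
  by move=> x /Mu; rewrite unitmxE unitfE.
apply: holomorphicM => //; first exact: holomorphic_cst.
apply: holomorphic_det => // k l.
by apply: (holomorphic_eq oU _ (hM (lift j k) (lift i l))) => x _; rewrite !mxE.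
Qed.

End Holomorphic.

(** * Adapted coframes and the Levi form *)

Section AdaptedCoframe.
Context {K : numFieldType}.
Local Notation H := 'rV[K]_5.

(** The covectors are those dual to [e1], [e2], [f1], [f2], [[e1, f1]], kept through their relations
    alone: the matrix that produces them does not appear. The last six fields turn the adaptedness
    conditions modulo C into equations for [th]. *)
Record adapted_coframe (U : set H) (E F : H -> {vspace H})
    (e1 e2 f1 f2 a1 a2 b1 b2 th : H -> H) : Prop := AdaptedCoframe {
  acf_open : open U;
  acf_frame : [/\ holomorphic U e1, holomorphic U e2, holomorphic U f1 &
    holomorphic U f2];
  acf_coframe : [/\ holomorphic U a1, holomorphic U a2, holomorphic U b1,
    holomorphic U b2 & holomorphic U th];
  acf_E : forall x, U x -> E x = <<[:: e1 x; e2 x]>>%VS;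
  acf_F : forall x, U x -> F x = <<[:: f1 x; f2 x]>>%VS;
  acf_free : forall x, U x -> free [:: e1 x; e2 x; f1 x; f2 x];
  acf_e1 : forall x, U x -> [/\ pairing (e1 x) (a1 x) = 1,
    pairing (e1 x) (a2 x) = 0, pairing (e1 x) (b1 x) = 0,
    pairing (e1 x) (b2 x) = 0 & pairing (e1 x) (th x) = 0];
  acf_e2 : forall x, U x -> [/\ pairing (e2 x) (a1 x) = 0,
    pairing (e2 x) (a2 x) = 1, pairing (e2 x) (b1 x) = 0,
    pairing (e2 x) (b2 x) = 0 & pairing (e2 x) (th x) = 0];
  acf_f1 : forall x, U x -> [/\ pairing (f1 x) (a1 x) = 0,
    pairing (f1 x) (a2 x) = 0, pairing (f1 x) (b1 x) = 1,
    pairing (f1 x) (b2 x) = 0 & pairing (f1 x) (th x) = 0];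
  acf_f2 : forall x, U x -> [/\ pairing (f2 x) (a1 x) = 0,
    pairing (f2 x) (a2 x) = 0, pairing (f2 x) (b1 x) = 0,
    pairing (f2 x) (b2 x) = 1 & pairing (f2 x) (th x) = 0];
  acf_expand : forall x u, U x -> pairing u (th x) = 0 ->
    u = pairing u (a1 x) *: e1 x + pairing u (a2 x) *: e2 x +
        pairing u (b1 x) *: f1 x + pairing u (b2 x) *: f2 x;
  acf_ee : forall x, U x -> pairing (lie e1 e2 x) (th x) = 0;
  acf_ff : forall x, U x -> pairing (lie f1 f2 x) (th x) = 0;
  acf_e1f2 : forall x, U x -> pairing (lie e1 f2 x) (th x) = 0;
  acf_e2f1 : forall x, U x -> pairing (lie e2 f1 x) (th x) = 0;
  acf_e1f1 : forall x, U x -> pairing (lie e1 f1 x) (th x) = 1;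
  acf_e2f2 : forall x, U x -> pairing (lie e2 f2 x) (th x) = 1 }.

(** Rank 4 of C makes the four fields free, and [[e1, f1]] lies outside C, so the five vectors are
    the rows of an invertible matrix; the columns of its inverse are the dual covectors. *)
Lemma exists_adapted_coframe (U : set H) (E F : H -> {vspace H})
    (e1 e2 f1 f2 : H -> H) :
  open U -> holomorphic U e1 -> holomorphic U e2 -> holomorphic U f1 ->
  holomorphic U f2 ->
  (forall x, U x -> let C := (E x + F x)%VS in
    [/\ E x = <<[:: e1 x; e2 x]>>%VS /\ F x = <<[:: f1 x; f2 x]>>%VS,
        lie e1 e2 x \in C /\ lie f1 f2 x \in C,
        lie e1 f2 x \in C /\ lie e2 f1 x \in C,
        lie e1 f1 x - lie e2 f2 x \in C & lie e1 f1 x \notin C]) ->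
  (forall x, U x -> \dim (E x + F x) = 4%N) ->
  exists a1 a2 b1 b2 th, adapted_coframe U E F e1 e2 f1 f2 a1 a2 b1 b2 th.
Proof.
move=> oU he1 he2 hf1 hf2 had hdim.
pose r := lie e1 f1.
pose T x : 5.-tuple H := [tuple e1 x; e2 x; f1 x; f2 x; r x].
pose M x : 'M[K]_5 := \matrix_(i, j) (T x)`_i 0 j.
pose c (k : nat) x : H := \row_l invmx (M x) l (inord k).
have Cspan x : U x -> (E x + F x = <<[:: e1 x; e2 x; f1 x; f2 x]>>)%VS.
  by move=> /had[[-> ->]] _ _ _ _; rewrite -span_cat.
have fr4 x : U x -> free [:: e1 x; e2 x; f1 x; f2 x].
  by move=> Ux; rewrite /free -Cspan // hdim.
have fr5 x : U x -> free (T x).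
  (* The bracket is moved to the front so that [free_cons] asks exactly for [[e1, f1]] outside the
     span of the other four. *)
  move=> Ux; rewrite (perm_free (Y := [:: r x; e1 x; e2 x; f1 x; f2 x])).
    by rewrite free_cons fr4 // -Cspan // andbT; have [] := had x Ux.
  by apply/permPl; exact: (perm_rcons (r x) [:: e1 x; e2 x; f1 x; f2 x]).
have Mu x : U x -> M x \in unitmx.
  move=> Ux; rewrite -row_free_unit; apply/inj_row_free => u uM.
  have /freeP fr := fr5 x Ux; apply/rowP => i; rewrite mxE.
  apply: (fr (fun i => u 0 i)); rewrite -[RHS]uM mulmx_sum_row.
  by apply: eq_bigr => k _; congr (_ *: _); apply/rowP => j; rewrite !mxE.
have pc u k x : pairing u (c k x) = (u *m invmx (M x)) 0 (inord k).
  by rewrite mxE; apply: eq_bigr => l _; rewrite mxE.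
have dual x i k : U x -> (i < 5)%N -> (k < 5)%N ->
    pairing (T x)`_i (c k x) = (i == k)%:R.
  move=> Ux i5 k5; rewrite pc.
  have -> : (T x)`_i = row (inord i) (M x) by apply/rowP => j; rewrite !mxE inordK.
  by rewrite -row_mul mulmxV ?Mu // !mxE -val_eqE /= !inordK.
have expand x u : U x -> u = \sum_(k < 5) pairing u (c k x) *: (T x)`_k.
  move=> Ux; rewrite -[LHS](mulmxKV (Mu x Ux)) mulmx_sum_row.
  apply: eq_bigr => k _; rewrite pc inord_val; congr (_ *: _).
  by apply/rowP => j; rewrite !mxE.
have hr : holomorphic U r by exact: holomorphic_lie.
have hc k : holomorphic U (c k).
  apply: holomorphic_rV => // j.
  apply: (@holomorphic_eq _ _ _ _ (fun x => invmx (M x) j (inord k))) => //.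
    by move=> x _; rewrite mxE.
  apply: holomorphic_invmx => // -[i i5] l.
  apply: (@holomorphic_eq _ _ _ _ (fun x => (T x)`_i 0 l)) => //.
    by move=> x _; rewrite mxE.
  apply: holomorphic_entry => //.
  by move: i i5 => [|[|[|[|[|]]]]].
(* The fifth dual covector kills the first four vectors, which span C. *)
have Cth x u : U x -> u \in (E x + F x)%VS -> pairing u (c 4%N x) = 0.
  move=> Ux; rewrite Cspan // => /(coord_span (X := [tuple e1 x; e2 x; f1 x; f2 x])) ->.
  rewrite !big_ord_recl big_ord0 /= addr0 !pairingDl !pairingZl.
  rewrite (dual x 0%N 4%N) // (dual x 1%N 4%N) // (dual x 2%N 4%N) //.
  by rewrite (dual x 3%N 4%N) // !mulr0 !addr0.
exists (c 0%N), (c 1%N), (c 2%N), (c 3%N), (c 4%N); split => //.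
- by move=> x /had[[]].
- by move=> x /had[[]].
- by move=> x Ux; split; exact: (dual x 0%N).
- by move=> x Ux; split; exact: (dual x 1%N).
- by move=> x Ux; split; exact: (dual x 2%N).
- by move=> x Ux; split; exact: (dual x 3%N).
- move=> x u Ux u0; rewrite {1}(expand x u Ux) !big_ord_recl big_ord0 /= addr0.
  by rewrite u0 scale0r addr0 !addrA.
- by move=> x Ux; have [_ [h _] _ _ _] := had x Ux; exact: Cth.
- by move=> x Ux; have [_ [_ h] _ _ _] := had x Ux; exact: Cth.
- by move=> x Ux; have [_ _ [h _] _ _] := had x Ux; exact: Cth.
- by move=> x Ux; have [_ _ [_ h] _ _] := had x Ux; exact: Cth.
- by move=> x Ux; exact: (dual x 4%N 4%N).
(* Since [[e1, f1] - [e2, f2]] lies in C, [th] takes on [[e2, f2]] the value 1 that it takes on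
   [[e1, f1]]. *)
- move=> x Ux; have [_ _ _ h _] := had x Ux.
  have := Cth x _ Ux h; rewrite pairingDl pairingNl (dual x 4%N 4%N) //.
  by move/eqP; rewrite subr_eq0 => /eqP <-.
Qed.

End AdaptedCoframe.

(** * Brackets of sections of a kernel, and maps pulled back to a product *)

Section Brackets.
Context {K : numFieldType}.

(* Differentiating <X, c> = <Y, c> = 0 shows that the bracket of two sections
   of ker c is tensorial modulo ker c. *)
Lemma bracket_pairing (P : normedModType K) n (X Y c : P -> 'rV[K]_n) p u v :
  differentiable X p -> differentiable Y p -> differentiable c p ->
  (\forall q \near p, pairing (X q) (c q) = 0) ->
  (\forall q \near p, pairing (Y q) (c q) = 0) ->
  pairing ('D_u Y p - 'D_v X p) (c p) =
  pairing (X p) ('D_v c p) - pairing (Y p) ('D_u c p).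
Proof.
move=> dX dY dc X0 Y0.
have HX : pairing ('D_v X p) (c p) = - pairing (X p) ('D_v c p).
  apply/eqP; rewrite -addr_eq0 -derive_pairing //.
  by rewrite (near_eq_derive (g := fun=> 0)) // derive_cst.
have HY : pairing ('D_u Y p) (c p) = - pairing (Y p) ('D_u c p).
  apply/eqP; rewrite -addr_eq0 -derive_pairing //.
  by rewrite (near_eq_derive (g := fun=> 0)) // derive_cst.
by rewrite pairingDl pairingNl HX HY opprK addrC.
Qed.

Lemma lie_fst (A B : normedModType K) (X Y : A * B -> A * B) p :
  differentiable X p -> differentiable Y p ->
  (lie X Y p).1 = 'D_(X p) (fun q => (Y q).1) p - 'D_(Y p) (fun q => (X q).1) p.
Proof. by move=> dX dY; rewrite /lie /= !derive_fst. Qed.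

Lemma lie_snd (A B : normedModType K) (X Y : A * B -> A * B) p :
  differentiable X p -> differentiable Y p ->
  (lie X Y p).2 = 'D_(X p) (fun q => (Y q).2) p - 'D_(Y p) (fun q => (X q).2) p.
Proof. by move=> dX dY; rewrite /lie /= !derive_snd. Qed.

Lemma derive_sndE (A B : normedModType K) (p w : A * B) : 'D_w snd p = w.2.
Proof. by rewrite -[snd]/(fun q : A * B => (id q).2) -derive_snd // derive_id. Qed.

Lemma derive_lift (A B W : normedModType K) (f : A -> W) (p w : A * B) :
  differentiable f p.1 -> 'D_w (fun q : A * B => f q.1) p = 'D_(w.1) f p.1.
Proof. by move=> df; rewrite (derive_linear_precomp (L := fst)) //; exact: fst_continuous. Qed.

Lemma differentiable_lift (A B W : normedModType K) (f : A -> W) (p : A * B) :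
  differentiable f p.1 -> differentiable (fun q : A * B => f q.1) p.
Proof. by apply: (linear_precomp_differentiable (L := fst)); exact: fst_continuous. Qed.

Lemma open_lift_dom (V : normedVectType K) (U : set V) : open U -> open (lift_dom U).
Proof. by move=> oU; move/continuousP: (@fst_continuous _ V K); apply. Qed.

Lemma holomorphic_lift (V : normedVectType K) (W : normedModType K) (U : set V)
    (f : V -> W) : open U ->
  holomorphic U f -> holomorphic (lift_dom U) (fun p => f p.1).
Proof.
by move=> oU; apply: (holomorphic_linear_precomp (L := fst)) => //; exact: fst_continuous.
Qed.

Lemma holomorphic_fibre (V : normedVectType K) (U : set V) : open U ->
  holomorphic (lift_dom U) (fun p => p.2).
Proof.
move=> oU; have oU' := open_lift_dom oU.
exact: (holomorphic_snd oU' (holomorphic_id oU')).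
Qed.

Lemma mem_span2 (V : vectType K) (u v w : V) :
  reflect (exists k l, w = k *: u + l *: v) (w \in <<[:: u; v]>>%VS).
Proof.
rewrite span_cons span_seq1; apply: (iffP memv_addP).
  by move=> [_ /vlineP[k ->] [_ /vlineP[l ->] ->]]; exists k, l.
by move=> [k [l ->]]; exists (k *: u); rewrite ?memvZ ?memv_line //;
   exists (l *: v); rewrite ?memvZ ?memv_line.
Qed.

End Brackets.

Section Levi.
Context {K : numFieldType}.
Local Notation H := 'rV[K]_5.
Variables (U : set H) (E F : H -> {vspace H}).
Variables (e1 e2 f1 f2 a1 a2 b1 b2 th : H -> H).
Hypothesis acf : adapted_coframe U E F e1 e2 f1 f2 a1 a2 b1 b2 th.

(** This is [-dth]. On sections of C it is [th] of their bracket, hence the Levi form eta read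
    through the trivialization of TN/C by [th]. *)
Definition levi x u v : K := pairing u ('D_v th x) - pairing v ('D_u th x).

Lemma leviC x u v : levi x u v = - levi x v u.
Proof. by rewrite /levi opprB. Qed.

Lemma leviDl x u v w : U x -> levi x (u + v) w = levi x u w + levi x v w.
Proof.
move=> Ux; have [_ _ _ _ hth] := acf_coframe acf.
have dth := holomorphic_differentiable hth Ux.
by rewrite /levi deriveDdir // pairingDl pairingDr opprD addrACA.
Qed.

Lemma leviZl x k u v : U x -> levi x (k *: u) v = k * levi x u v.
Proof.
move=> Ux; have [_ _ _ _ hth] := acf_coframe acf.
have dth := holomorphic_differentiable hth Ux.
by rewrite /levi deriveZdir // pairingZl pairingZr mulrBr.
Qed.

Lemma leviDr x u v w : U x -> levi x w (u + v) = levi x w u + levi x w v.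
Proof. by move=> Ux; rewrite leviC leviDl // opprD (leviC x w u) (leviC x w v). Qed.

Lemma leviZr x k u v : U x -> levi x u (k *: v) = k * levi x u v.
Proof. by move=> Ux; rewrite leviC leviZl // (leviC x u v) mulrN. Qed.

Lemma lie_levi x (X Y : H -> H) : U x -> differentiable X x -> differentiable Y x ->
  (\forall y \near x, pairing (X y) (th y) = 0) ->
  (\forall y \near x, pairing (Y y) (th y) = 0) ->
  pairing (lie X Y x) (th x) = levi x (X x) (Y x).
Proof.
move=> Ux dX dY X0 Y0; have [_ _ _ _ hth] := acf_coframe acf.
by apply: bracket_pairing => //; exact: holomorphic_differentiable hth Ux.
Qed.

Let nearU x (Q : H -> Prop) : U x -> (forall y, U y -> Q y) -> \forall y \near x, Q y.
Proof.
move=> Ux HQ; apply: filterS (open_nbhs_nbhs (conj (acf_open acf) Ux)) => y; exact: HQ.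
Qed.

Lemma levi_frame x : U x ->
  [/\ levi x (e1 x) (e2 x) = 0, levi x (f1 x) (f2 x) = 0,
      levi x (e1 x) (f2 x) = 0, levi x (e2 x) (f1 x) = 0 &
      levi x (e1 x) (f1 x) = 1 /\ levi x (e2 x) (f2 x) = 1].
Proof.
move=> Ux; have [h1 h2 h3 h4] := acf_frame acf.
have d (X : H -> H) (hX : holomorphic U X) := holomorphic_differentiable hX Ux.
have n1 : \forall y \near x, pairing (e1 y) (th y) = 0.
  by apply: nearU => // y /(acf_e1 acf)[].
have n2 : \forall y \near x, pairing (e2 y) (th y) = 0.
  by apply: nearU => // y /(acf_e2 acf)[].
have n3 : \forall y \near x, pairing (f1 y) (th y) = 0.
  by apply: nearU => // y /(acf_f1 acf)[].
have n4 : \forall y \near x, pairing (f2 y) (th y) = 0.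
  by apply: nearU => // y /(acf_f2 acf)[].
split; [| | | |split].
- rewrite -(lie_levi Ux (d _ h1) (d _ h2) n1 n2); exact: (acf_ee acf Ux).
- rewrite -(lie_levi Ux (d _ h3) (d _ h4) n3 n4); exact: (acf_ff acf Ux).
- rewrite -(lie_levi Ux (d _ h1) (d _ h4) n1 n4); exact: (acf_e1f2 acf Ux).
- rewrite -(lie_levi Ux (d _ h2) (d _ h3) n2 n3); exact: (acf_e2f1 acf Ux).
- rewrite -(lie_levi Ux (d _ h1) (d _ h3) n1 n3); exact: (acf_e1f1 acf Ux).
- rewrite -(lie_levi Ux (d _ h2) (d _ h4) n2 n4); exact: (acf_e2f2 acf Ux).
Qed.

Lemma levi_diag x u : levi x u u = 0.
Proof. by rewrite /levi subrr. Qed.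

(** The frame is symplectic for [-dth] on C: [e1] pairs with [f1], [e2] with [f2], and all other
    pairs are orthogonal. Bilinearity does the rest. *)
Lemma leviE x u v : U x -> pairing u (th x) = 0 -> pairing v (th x) = 0 ->
  levi x u v =
    pairing u (a1 x) * pairing v (b1 x) - pairing u (b1 x) * pairing v (a1 x) +
    (pairing u (a2 x) * pairing v (b2 x) - pairing u (b2 x) * pairing v (a2 x)).
Proof.
move=> Ux u0 v0.
have [l12 m12 l1m2 l2m1 [l11 l22]] := levi_frame Ux.
rewrite {1}(acf_expand acf Ux u0) {1}(acf_expand acf Ux v0).
rewrite !(leviDl, leviDr, leviZl, leviZr) // !levi_diag.
rewrite (leviC x (e2 x) (e1 x)) (leviC x (f2 x) (f1 x)) (leviC x (f1 x) (e1 x)).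
rewrite (leviC x (f1 x) (e2 x)) (leviC x (f2 x) (e1 x)) (leviC x (f2 x) (e2 x)).
rewrite l12 m12 l1m2 l2m1 l11 l22.
move: (pairing u (a1 x)) (pairing u (a2 x)) (pairing u (b1 x)) (pairing u (b2 x))
  (pairing v (a1 x)) (pairing v (a2 x)) (pairing v (b1 x)) (pairing v (b2 x))
  => k1 k2 k3 k4 m1 m2 m3 m4; ring.
Qed.

Lemma mem_E x u : U x -> (u \in E x) <->
  [/\ pairing u (th x) = 0, pairing u (b1 x) = 0 & pairing u (b2 x) = 0].
Proof.
move=> Ux; rewrite (acf_E acf Ux).
have [p11 p12 q11 q12 r1] := acf_e1 acf Ux; have [p21 p22 q21 q22 r2] := acf_e2 acf Ux.
split=> [/mem_span2[k [l ->]]|[u0 v0 w0]].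
  by rewrite !(pairingDl, pairingZl) q11 q12 r1 q21 q22 r2 !mulr0 !addr0.
apply/mem_span2; exists (pairing u (a1 x)), (pairing u (a2 x)).
by rewrite {1}(acf_expand acf Ux u0) v0 w0 !scale0r !addr0.
Qed.

Lemma mem_F x u : U x -> (u \in F x) <->
  [/\ pairing u (th x) = 0, pairing u (a1 x) = 0 & pairing u (a2 x) = 0].
Proof.
move=> Ux; rewrite (acf_F acf Ux).
have [p11 p12 q11 q12 r1] := acf_f1 acf Ux; have [p21 p22 q21 q22 r2] := acf_f2 acf Ux.
split=> [/mem_span2[k [l ->]]|[u0 v0 w0]].
  by rewrite !(pairingDl, pairingZl) p11 p12 r1 p21 p22 r2 !mulr0 !addr0.
apply/mem_span2; exists (pairing u (b1 x)), (pairing u (b2 x)).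
by rewrite {1}(acf_expand acf Ux u0) v0 w0 !scale0r !add0r.
Qed.

Lemma mem_C x u : U x -> (u \in (E x + F x)%VS) <-> pairing u (th x) = 0.
Proof.
move=> Ux; split=> [/memv_addP[v /(mem_E _ Ux)[v0 _ _] [w /(mem_F _ Ux)[w0 _ _] ->]]|u0].
  by rewrite pairingDl v0 w0 addr0.
rewrite (acf_expand acf Ux u0) -addrA; apply: memv_add.
  by rewrite (acf_E acf Ux); apply/mem_span2; do 2!eexists.
by rewrite (acf_F acf Ux); apply/mem_span2; do 2!eexists.
Qed.

(** Freeness makes [coord] invert the expansion in the frame. This ties [coframe], which is
    meaningful only on C, to the holomorphic covectors defined everywhere. *)
Lemma coframeE p w : U p.1 -> pairing w.1 (th p.1) = 0 ->
  let cf j := coframe e1 e2 f1 f2 (inord j) p w in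
  [/\ cf 0%N = pairing w.1 (a1 p.1), cf 1%N = pairing w.1 (a2 p.1),
      cf 2%N = pairing w.1 (b1 p.1) & cf 3%N = pairing w.1 (b2 p.1)].
Proof.
move=> Ux w0; set c := fun j : nat => nth 0 [:: pairing w.1 (a1 p.1);
  pairing w.1 (a2 p.1); pairing w.1 (b1 p.1); pairing w.1 (b2 p.1)] j.
suff cE j : coframe e1 e2 f1 f2 j p w = c j.
  by move=> cf; rewrite /cf !cE !inordK.
rewrite /coframe {1}(acf_expand acf Ux w0).
rewrite -(coord_sum_free (fun i : 'I_4 => c i) j (acf_free acf Ux)).
by congr (coord _ _ _); rewrite !big_ord_recl big_ord0 /= addr0 !addrA.
Qed.

(** [levi_null] quantifies over all extensions of [u] and [v] to sections of C, but the bracket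
    modulo C depends only on the two values; one explicit extension is enough for the direct
    implication. *)
Lemma levi_nullP x u v : U x -> pairing u (th x) = 0 -> pairing v (th x) = 0 ->
  levi_null U (fun y => E y + F y)%VS x u v <-> levi x u v = 0.
Proof.
move=> Ux u0 v0; have oU := acf_open acf; split.
  have [h1 h2 h3 h4] := acf_frame acf.
  (* Freezing the frame coefficients of [w] at [x] extends it to a holomorphic section of C over all
     of [U]. *)
  pose ext w y : H := pairing w (a1 x) *: e1 y + pairing w (a2 x) *: e2 y +
    pairing w (b1 x) *: f1 y + pairing w (b2 x) *: f2 y.
  have hext w : holomorphic U (ext w).
    have hs k (X : H -> H) : holomorphic U X -> holomorphic U (fun y => k *: X y).
      by move=> hX; apply: holomorphic_scaler => //; exact: holomorphic_cst.
    exact: holomorphicD oU (holomorphicD oU (holomorphicD oU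
      (hs _ _ h1) (hs _ _ h2)) (hs _ _ h3)) (hs _ _ h4).
  have ext0 w y : U y -> pairing (ext w y) (th y) = 0.
    move=> Uy; rewrite /ext !pairingDl !pairingZl.
    have [_ _ _ _ ->] := acf_e1 acf Uy; have [_ _ _ _ ->] := acf_e2 acf Uy.
    have [_ _ _ _ ->] := acf_f1 acf Uy; have [_ _ _ _ ->] := acf_f2 acf Uy.
    by rewrite !mulr0 !addr0.
  have extx w : pairing w (th x) = 0 -> ext w x = w.
    by move=> w0; rewrite /ext -(acf_expand acf Ux w0).
  have sec w : holo_section U (fun y => E y + F y)%VS (ext w).
    by split=> // y Uy; apply/(mem_C _ Uy); exact: ext0.
  move=> h; have := h U _ _ oU (fun _ => id) Ux (sec u) (sec v) (extx u u0) (extx v v0).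
  move/(mem_C _ Ux) => <-; rewrite -{1}(extx u u0) -{1}(extx v v0).
  have dext w := holomorphic_differentiable (hext w) Ux.
  exact: esym (lie_levi Ux (dext u) (dext v) (nearU Ux (ext0 u)) (nearU Ux (ext0 v))).
move=> l0 W X Y oW WU Wx [hX tX] [hY tY] Xx Yx; apply/(mem_C _ Ux).
rewrite lie_levi ?Xx ?Yx //.
- exact: holomorphic_differentiable hX Wx.
- exact: holomorphic_differentiable hY Wx.
- apply: filterS (open_nbhs_nbhs (conj oW Wx)) => y Wy.
  by apply/(mem_C _ (WU _ Wy)); exact: tX.
- apply: filterS (open_nbhs_nbhs (conj oW Wx)) => y Wy.
  by apply/(mem_C _ (WU _ Wy)); exact: tY.
Qed.

End Levi.

(** * Forms on the lift *)

Section LiftedForms.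
Context {K : numFieldType}.
Local Notation H := 'rV[K]_5.
Local Notation P := (H * K)%type.
Implicit Types (p w u v : P).

(* The 2-form -dc, where c stands for the 1-form w |-> <w.1, c p> on the lift. *)
Definition dform (c : P -> H) p u v : K :=
  pairing u.1 ('D_v c p) - pairing v.1 ('D_u c p).

Lemma dformC c p u v : dform c p u v = - dform c p v u.
Proof. by rewrite /dform opprB. Qed.

Lemma dform_diag c p u : dform c p u u = 0.
Proof. by rewrite /dform subrr. Qed.

Lemma dformDl c p u v w : differentiable c p ->
  dform c p (u + v) w = dform c p u w + dform c p v w.
Proof. by move=> dc; rewrite /dform deriveDdir // pairingDl pairingDr opprD addrACA. Qed.

Lemma dformZl c p k u v : differentiable c p ->
  dform c p (k *: u) v = k * dform c p u v.
Proof. by move=> dc; rewrite /dform deriveZdir // pairingZl pairingZr mulrBr. Qed.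

Lemma dformDr c p u v w : differentiable c p ->
  dform c p w (u + v) = dform c p w u + dform c p w v.
Proof. by move=> dc; rewrite dformC dformDl // opprD (dformC c p w u) (dformC c p w v). Qed.

Lemma dformZr c p k u v : differentiable c p ->
  dform c p u (k *: v) = k * dform c p u v.
Proof. by move=> dc; rewrite dformC dformZl // (dformC c p u v) mulrN. Qed.

Lemma dform_minor c p (e f : P) (x1 x2 y1 y2 : K) : differentiable c p ->
  dform c p (x1 *: e + x2 *: f) (y1 *: e + y2 *: f) =
  (x1 * y2 - x2 * y1) * dform c p e f.
Proof.
move=> dc; rewrite !(dformDl, dformDr, dformZl, dformZr) // !dform_diag.
rewrite (dformC c p f e); move: (dform c p e f) => q; ring.
Qed.

(** The minors are the coordinates of the wedge of the two vectors, which is all that an alternating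
    form sees. *)
Lemma dform_minors c p (e f g : P) (x1 x2 x3 y1 y2 y3 : K) : differentiable c p ->
  dform c p (x1 *: e + x2 *: f + x3 *: g) (y1 *: e + y2 *: f + y3 *: g) =
  (x1 * y2 - x2 * y1) * dform c p e f + (x1 * y3 - x3 * y1) * dform c p e g +
  (x2 * y3 - x3 * y2) * dform c p f g.
Proof.
move=> dc; rewrite !(dformDl, dformDr, dformZl, dformZr) // !dform_diag.
rewrite (dformC c p f e) (dformC c p g e) (dformC c p g f).
move: (dform c p e f) (dform c p e g) (dform c p f g) => q1 q2 q3; ring.
Qed.

Lemma lie_dform c p (X Y : P -> P) :
  differentiable c p -> differentiable X p -> differentiable Y p ->
  (\forall q \near p, pairing (X q).1 (c q) = 0) ->
  (\forall q \near p, pairing (Y q).1 (c q) = 0) ->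
  pairing (lie X Y p).1 (c p) = dform c p (X p) (Y p).
Proof.
move=> dc dX dY X0 Y0; rewrite lie_fst //.
by rewrite (@bracket_pairing K _ _ (fun q => (X q).1) (fun q => (Y q).1)) //;
  exact: differentiable_fst.
Qed.

End LiftedForms.

(** * Functions polynomial along the fibres of the lift *)

Section FibrePolynomials.
Context {K : numFieldType}.
Local Notation H := 'rV[K]_5.
Local Notation P := (H * K)%type.
Variable U : set H.
Hypothesis oU : open U.
Implicit Types (f g : P -> K).

(** Here [d] counts coefficients, as [size] does for polynomials, so the degree is less than [d].
    The coefficients are holomorphic on the base so that they can be differentiated there. *)
Definition fibre_poly d f := exists c : nat -> H -> K,
  (forall i, holomorphic U (c i)) /\
  forall p, U p.1 -> f p = \sum_(i < d) c i p.1 * p.2 ^+ i.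

Lemma fibre_polyD d f g : fibre_poly d f -> fibre_poly d g ->
  fibre_poly d (fun p => f p + g p).
Proof.
move=> [a [ha fE]] [b [hb gE]]; exists (fun i x => a i x + b i x).
split=> [i|p Up]; first exact: holomorphicD.
by rewrite fE // gE // -big_split; apply: eq_bigr => i _ /=; rewrite -mulrDl.
Qed.

Lemma fibre_polyN d f : fibre_poly d f -> fibre_poly d (fun p => - f p).
Proof.
move=> [a [ha fE]]; exists (fun i x => - a i x).
split=> [i|p Up]; first exact: holomorphicN.
by rewrite fE // -sumrN; apply: eq_bigr => i _; rewrite mulNr.
Qed.

Lemma fibre_polyX d f : fibre_poly d f -> fibre_poly d.+1 (fun p => p.2 * f p).
Proof.
move=> [a [ha fE]]; exists (fun i => if i is j.+1 then a j else fun=> 0).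
split=> [[|i]|p Up] //; first exact: holomorphic_cst.
rewrite fE // big_ord_recl mul0r add0r big_distrr.
by apply: eq_bigr => i _ /=; rewrite mulrCA exprS.
Qed.

Lemma fibre_polyW d f : fibre_poly d f -> fibre_poly d.+1 f.
Proof.
move=> [a [ha fE]]; exists (fun i => if (i < d)%N then a i else fun=> 0).
split=> [i|p Up]; first by case: ifP => // _; exact: holomorphic_cst.
rewrite fE // big_ord_recr /= ltnn mul0r addr0.
by apply: eq_bigr => i _; rewrite ltn_ord.
Qed.

Lemma fibre_poly_eq d f g : (forall p, U p.1 -> f p = g p) ->
  fibre_poly d f -> fibre_poly d g.
Proof. by move=> fg [a [ha fE]]; exists a; split=> // p Up; rewrite -fg // fE. Qed.

Lemma fibre_poly_quadratic (a b c : H -> K) :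
  holomorphic U a -> holomorphic U b -> holomorphic U c ->
  fibre_poly 3 (fun p => a p.1 + b p.1 * p.2 + c p.1 * p.2 ^+ 2).
Proof.
move=> ha hb hc; exists (fun i => nth (fun=> 0) [:: a; b; c] i).
split=> [[|[|[|i]]]|p _] //=; first by rewrite nth_nil; exact: holomorphic_cst.
by rewrite !big_ord_recl big_ord0 /= expr0 expr1 mulr1 addr0 addrA.
Qed.

Lemma holomorphic_fibre_poly d f : fibre_poly d f -> holomorphic (lift_dom U) f.
Proof.
have oU' := open_lift_dom oU.
move=> [a [ha fE]]; apply: (@holomorphic_eq K P K _
  (fun p : P => \sum_(i < d) a i p.1 * p.2 ^+ i)) => //.
  by move=> p Up; rewrite fE.
apply: holomorphic_sum => // i _; apply: holomorphicM => //.
  exact: holomorphic_lift.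
by apply: holomorphicX => //; exact: holomorphic_fibre.
Qed.

(** A vertical derivative is the formal derivative in [t]; a horizontal one acts on the coefficients
    only and so does not raise the degree. *)
Lemma fibre_poly_horner d f x : U x -> fibre_poly d f ->
  (exists2 p : {poly K}, (size p <= d)%N &
    forall t, f (x, t) = p.[t] /\ 'D_(0, 1) f (x, t) = (deriv p).[t]) /\
  (forall u, exists2 p : {poly K}, (size p <= d)%N &
    forall t, 'D_(u, 0) f (x, t) = p.[t]).
Proof.
move=> Ux [a [ha fE]]; have oU' := open_lift_dom oU.
(* At [i = 0] the exponent [0.-1] is a default value, and the factor [*+ 0] kills that term. *)
have DE t w : 'D_w f (x, t) =
    \sum_(i < d) ('D_(w.1) (a i) x * t ^+ i + a i x * (w.2 * (t ^+ i.-1 *+ i))).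
  have Up : lift_dom U (x, t) by [].
  have -> : 'D_w f (x, t) = 'D_w (\sum_(i < d) (fun p : P => a i p.1 * p.2 ^+ i)) (x, t).
    apply: near_eq_derive; apply: filterS (open_nbhs_nbhs (conj oU' Up)) => q Uq.
    by rewrite fE // fct_sumE.
  have da i : differentiable (fun p : P => a i p.1) (x, t).
    by apply: differentiable_lift; exact: holomorphic_differentiable (ha i) Ux.
  have ds : derivable (snd : P -> K) (x, t) w.
    exact: diff_derivable (holomorphic_differentiable (holomorphic_fibre oU) Up).
  have XE i : (fun p : P => p.2 ^+ i : K) = (snd : P -> K) ^+ i by rewrite exprfctE.
  have dX i : derivable (fun p : P => p.2 ^+ i : K) (x, t) w.
    by rewrite XE; exact: derivableX.
  rewrite derive_sum => [|i]; last first.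
    exact: derivableM (diff_derivable (da i)) (dX i).
  apply: eq_bigr => i _; rewrite (deriveM (diff_derivable (da i)) (dX i)).
  have -> : 'D_w (fun p : P => p.2 ^+ i : K) (x, t) = w.2 * (t ^+ i.-1 *+ i).
    by rewrite XE (deriveX i ds) derive_sndE -[_ *+ i in RHS]mulr_natl; exact: mulrC.
  rewrite derive_lift; last exact: holomorphic_differentiable (ha i) Ux.
  by rewrite addrC; congr (_ + _); exact: mulrC.
split=> [|u].
  exists (\poly_(i < d) a i x) => [|t]; first exact: size_poly.
  split; first by rewrite fE // horner_poly.
  rewrite DE poly_def raddf_sum /= horner_sum; apply: eq_bigr => i _.
  rewrite derive0 mul0r add0r mul1r derivZ derivXn.
  by rewrite hornerZ hornerMn hornerXn.
exists (\poly_(i < d) 'D_u (a i) x) => [|t]; first exact: size_poly.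
rewrite DE horner_poly; apply: eq_bigr => i _ /=.
by rewrite mul0r mulr0 addr0.
Qed.

End FibrePolynomials.

(* One less than the size of either product: the leading terms cancel. *)
Lemma size_wronskian (F : fieldType) (p q : {poly F}) d :
  (size p <= d.+1)%N -> (size q <= d.+1)%N ->
  (size (deriv p * q - p * deriv q)%R <= d.*2.-1)%N.
Proof.
move=> sp sq; pose w (a b : {poly F}) := deriv a * b - a * deriv b.
have wDl a b c : w (a + b) c = w a c + w b c by rewrite /w derivD; ring.
have wDr a b c : w a (b + c) = w a b + w a c by rewrite /w derivD; ring.
have wZl k a b : w (k *: a) b = k *: w a b.
  by rewrite /w derivZ scalerBr -!scalerAl.
have wZr k a b : w a (k *: b) = k *: w a b.
  by rewrite /w derivZ scalerBr -!scalerAr.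
(* On monomials the expression is [(i - j) X^(i + j - 1)]: it vanishes for [i = j], and otherwise
   [i + j] is at most [2d - 1]. Bilinearity extends this bound to all polynomials. *)
have wX i j : (i <= d)%N -> (j <= d)%N -> (size (w 'X^i 'X^j) <= d.*2.-1)%N.
  move=> id jd; have [->|ij] := eqVneq i j.
    by rewrite /w mulrC subrr size_poly0.
  have ijd : (i + j <= d.*2.-1)%N by move/eqP: ij; lia.
  rewrite /w !derivXn mulrnAl mulrnAr -!exprD.
  apply: leq_trans (size_polyD _ _) _; rewrite size_polyN geq_max.
  apply/andP; split; (case: (posnP i) (posnP j) => [->|i0] [->|j0]);
    rewrite ?mulr0n ?size_poly0 //;
    by rewrite -scaler_nat (leq_trans (size_scale_leq _ _)) ?size_polyXn; lia.
have pE (r : {poly F}) : (size r <= d.+1)%N -> r = \sum_(i < d.+1) r`_i *: 'X^i.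
  move=> sr; rewrite -poly_def; apply/polyP => i; rewrite coef_poly.
  by case: ltnP => // di; rewrite nth_default // (leq_trans sr).
have w0l b : w 0 b = 0 by have := wZl 0 0 b; rewrite !scale0r.
have w0r b : w b 0 = 0 by have := wZr 0 b 0; rewrite !scale0r.
rewrite -/(w p q) (pE p sp).
elim/big_ind: _ => [|a b ha hb|i _]; first by rewrite w0l size_poly0.
  by rewrite wDl (leq_trans (size_polyD _ _)) // geq_max ha.
rewrite wZl (leq_trans (size_scale_leq _ _)) // (pE q sq).
elim/big_ind: _ => [|a b ha hb|j _]; first by rewrite w0r size_poly0.
  by rewrite wDr (leq_trans (size_polyD _ _)) // geq_max ha.
by rewrite wZr (leq_trans (size_scale_leq _ _)) // wX // -ltnS.
Qed.

(** * Distributions of rank 1 and 2 *)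

Section LineFields.
Context {K : numFieldType}.

Lemma vline_eq (V : vectType K) (u v : V) : u \in <[v]>%VS -> u != 0 -> <[u]>%VS = <[v]>%VS.
Proof.
move=> uv u0; apply/eqP; rewrite eqEdim -memvE uv !dim_vline u0.
by case: (v != 0).
Qed.

Lemma distribution_line (V : normedVectType K) (U : set V) (X : V -> V) : open U ->
  holomorphic U X -> (forall x, U x -> X x != 0) ->
  is_distribution U 1 (fun x => <[X x]>%VS).
Proof.
move=> oU hX X0 x Ux; exists U, (fun=> X); split=> // y Uy.
rewrite (_ : tval _ = [:: X y]) ?seq1_basis ?X0 //.
by rewrite /= enum_ordSl enum_ord0.
Qed.

Lemma distribution_plane (V : normedVectType K) (U : set V) (X Y : V -> V) : open U ->
  holomorphic U X -> holomorphic U Y -> (forall x, U x -> free [:: X x; Y x]) ->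
  is_distribution U 2 (fun x => <<[:: X x; Y x]>>%VS).
Proof.
move=> oU hX hY XY x Ux; exists U, (fun j => if j == 0 then X else Y).
split=> // [j|y Uy]; first by case: ifP.
rewrite (_ : tval _ = [:: X y; Y y]) ?/basis_of ?eqxx ?XY //.
by rewrite /= !enum_ordSl enum_ord0.
Qed.

(** A holomorphic local generator is a section of the unknown line field, so the condition that
    characterizes the field can be applied to its own generator. *)
Lemma distribution_line_frame (V : normedVectType K) (U : set V) (L : V -> {vspace V}) x :
  is_distribution U 1 L -> U x -> exists W X, [/\ open W, W x, W `<=` U,
    holomorphic W X & forall y, W y -> L y = <[X y]>%VS /\ X y != 0].
Proof.
move=> /(_ x) dL /dL[W [X [oW Wx WU hX XB]]]; exists W, (X 0); split=> // y Wy.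
have := XB y Wy; rewrite (_ : tval _ = [:: X 0 y]); last first.
  by rewrite /= enum_ordSl enum_ord0.
move=> B; split; first by rewrite -(span_basis B) span_seq1.
by rewrite (basis_not0 B) ?mem_head.
Qed.

Lemma distribution_plane_frame (V : normedVectType K) (U : set V) (L : V -> {vspace V}) x :
  is_distribution U 2 L -> U x -> exists W X Y, [/\ open W, W x, W `<=` U,
    holomorphic W X /\ holomorphic W Y & forall y, W y ->
    L y = <<[:: X y; Y y]>>%VS /\ free [:: X y; Y y]].
Proof.
move=> /(_ x) dL /dL[W [X [oW Wx WU hX XB]]]; exists W, (X 0), (X 1); split=> // y Wy.
have := XB y Wy; rewrite (_ : tval _ = [:: X 0 y; X 1 y]); last first.
  rewrite /= !enum_ordSl enum_ord0 /=; congr [:: _; X _ _].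
  exact/val_inj.
by move=> B; rewrite -(span_basis B) (basis_free B).
Qed.

Lemma free2P (V : vectType K) (u v : V) :
  reflect (forall k l, k *: u + l *: v = 0 -> k = 0 /\ l = 0) (free [:: u; v]).
Proof.
apply: (iffP (@freeP _ _ _ [tuple u; v])) => [uv k l kl|uv k].
  have := uv (fun i => if i == 0 then k else l).
  by rewrite !big_ord_recl big_ord0 /= addr0 => /(_ kl) h; split; [exact: (h 0)|exact: (h 1)].
rewrite !big_ord_recl big_ord0 /= addr0 => /uv[k0 k1] i.
by case: (unliftP 0 i) => [j|] -> //; rewrite ord1.
Qed.

(** When all minors vanish, the two coefficient rows are proportional, and the same relation holds
    between the vectors whether or not [e], [f], [g] are independent. *)
Lemma free2_minors (V : vectType K) (e f g : V) (x1 x2 x3 y1 y2 y3 : K) :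
  free [:: x1 *: e + x2 *: f + x3 *: g; y1 *: e + y2 *: f + y3 *: g] ->
  ~ [/\ x1 * y2 - x2 * y1 = 0, x1 * y3 - x3 * y1 = 0 & x2 * y3 - x3 * y2 = 0].
Proof.
move=> /free2P fr [/eqP m12 /eqP m13 /eqP m23].
move: m12 m13 m23; rewrite !subr_eq0 => /eqP m12 /eqP m13 /eqP m23.
have D k l : k * x1 + l * y1 = 0 -> k * x2 + l * y2 = 0 -> k * x3 + l * y3 = 0 ->
    k = 0 /\ l = 0.
  move=> h1 h2 h3; apply: fr.
  rewrite !scalerDr !scalerA addrACA -scalerDl h3 addrACA -!scalerDl h1 h2.
  by rewrite !scale0r !addr0.
(* With X and Y the two vectors, the combination [y1 X - x1 Y] has every coefficient equal to a
   minor up to sign, so freeness forces [x1 = 0]; likewise for [x2] and [x3]. *)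
have [_ /eqP] : y1 = 0 /\ - x1 = 0 by apply: D; rewrite mulNr ?m12 ?m13; ring.
rewrite oppr_eq0 => /eqP x10.
have [_ /eqP] : y2 = 0 /\ - x2 = 0 by apply: D; rewrite mulNr -?m12 ?m23; ring.
rewrite oppr_eq0 => /eqP x20.
have [_ /eqP] : y3 = 0 /\ - x3 = 0 by apply: D; rewrite mulNr -?m13 -?m23; ring.
rewrite oppr_eq0 => /eqP x30.
(* Now the whole first vector is zero, so [1 X + 0 Y = 0] contradicts freeness. *)
have [/eqP] : 1 = 0 :> K /\ 0 = 0 :> K by apply: D; rewrite ?x10 ?x20 ?x30; ring.
by rewrite oner_eq0.
Qed.

End LineFields.

(** * Holomorphy of brackets on the product of the base and the fibre *)

Section LiftedBrackets.
Context {K : numFieldType} {n : nat}.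
Local Notation P := ('rV[K]_n * K)%type.

Lemma holomorphic_scaler_lift (W : set P) (k : P -> K) (f : P -> P) : open W ->
  holomorphic W k -> holomorphic W f -> holomorphic W (fun p => k p *: f p).
Proof.
move=> oW hk hf.
apply: (@holomorphic_eq _ _ _ _ (fun p => (k p *: (f p).1, k p * (f p).2))) => //.
apply: holomorphic_pair => //.
  by apply: holomorphic_scaler => //; exact: holomorphic_fst.
by apply: holomorphicM => //; exact: holomorphic_snd.
Qed.

Lemma holomorphic_lie_lift (W : set P) (X Y : P -> P) : open W ->
  holomorphic W X -> holomorphic W Y -> holomorphic W (lie X Y).
Proof.
move=> oW.
suff H (Z f : P -> P) : holomorphic W Z -> holomorphic W f ->
    holomorphic W (fun p => 'D_(Z p) f p).
  by move=> hX hY; apply: holomorphicB => //; exact: H.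
move=> hZ hf.
apply: (@holomorphic_eq _ _ _ _ (fun p => \sum_k (Z p).1 0 k *: 'D_('e_k, 0) f p +
    (Z p).2 *: 'D_(0, 1) f p)) => //.
  move=> p Wp; have df := holomorphic_differentiable hf Wp.
  have ZE : Z p = \sum_k (Z p).1 0 k *: ('e_k, 0) + (Z p).2 *: (0, 1).
    rewrite [LHS]surjective_pairing [RHS]surjective_pairing; congr (_, _) => /=.
      rewrite scaler0 addr0 [LHS](row_sum_delta (Z p).1) (raddf_sum fst).
      by apply: eq_bigr => k _.
    rewrite (raddf_sum snd) big1 ?add0r => [|k _] /=; last by rewrite scaler0.
    exact: esym (mulr1 _).
  rewrite [in RHS]ZE (deriveDdir _ _ df) (deriveZdir _ _ df); congr (_ + _).
  rewrite (deriveE _ df) linear_sum; apply: eq_bigr => k _.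
  by rewrite linearZ (deriveE _ df).
apply: holomorphicD => //.
  apply: holomorphic_sum => // k _; apply: holomorphic_scaler_lift => //.
    by apply: holomorphic_entry => //; exact: holomorphic_fst.
  exact: holomorphic_derive.
apply: holomorphic_scaler_lift => //; first exact: holomorphic_snd.
exact: holomorphic_derive.
Qed.
End LiftedBrackets.

(** * The lifted distribution *)

Section LiftFrame.
Context {K : numFieldType}.
Local Notation H := 'rV[K]_5.
Local Notation P := (H * K)%type.
Implicit Types (p w : P).
Variables (U : set H) (E F : H -> {vspace H}).
Variables (e1 e2 f1 f2 a1 a2 b1 b2 th : H -> H).
Hypothesis acf : adapted_coframe U E F e1 e2 f1 f2 a1 a2 b1 b2 th.

Local Notation FE := (field_E e1 e2).
Local Notation FF := (field_F f1 f2).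
Local Notation FS := (field_S e1 e2 f1 f2).
Local Notation LD := (lift_D e1 e2 f1 f2).
Local Notation LD2 := (lift_D2 E F).
Local Notation dd := (@ddt K H).
Local Notation U' := (lift_dom U).
Local Notation aA1 := (A1 e1 e2 f1 f2).
Local Notation aA2 := (A2 e1 e2 f1 f2).
Local Notation l1 := (ell1 e1 e2 f1 f2).
Local Notation l2 := (ell2 e1 e2 f1 f2).

Definition thl p : H := th p.1.
Definition al p : H := a2 p.1 - p.2 *: a1 p.1.
Definition be p : H := b1 p.1 + p.2 *: b2 p.1.

Definition hE p : H := e1 p.1 + p.2 *: e2 p.1.
Definition hF p : H := p.2 *: f1 p.1 - f2 p.1.

Lemma field_EE p : FE p = (hE p, 0).
Proof. by rewrite /field_E /lift_field; congr (_, _); rewrite /= scaler0 addr0. Qed.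

Lemma field_FE p : FF p = (hF p, 0).
Proof. by rewrite /field_F /lift_field; congr (_, _); rewrite /= scaler0 subr0. Qed.

Lemma scale_ddt k p : k *: dd p = (0, k).
Proof. by rewrite [LHS]surjective_pairing /= scaler0; congr (_, _); exact: mulr1. Qed.

Lemma nearU' p (Q : P -> Prop) : U' p -> (forall q, U' q -> Q q) -> \forall q \near p, Q q.
Proof.
move=> Up HQ; apply: filterS (open_nbhs_nbhs (conj (open_lift_dom (acf_open acf)) Up)).
exact: HQ.
Qed.

Let oU := acf_open acf.
Let oU' := open_lift_dom (acf_open acf).

Lemma holomorphic_hE : holomorphic U' hE.
Proof.
have [h1 h2 _ _] := acf_frame acf.
apply: holomorphicD => //; first exact: holomorphic_lift.
apply: holomorphic_scaler => //; [exact: holomorphic_fibre|exact: holomorphic_lift].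
Qed.

Lemma holomorphic_hF : holomorphic U' hF.
Proof.
have [_ _ h1 h2] := acf_frame acf.
apply: holomorphicB => //; last exact: holomorphic_lift.
apply: holomorphic_scaler => //; [exact: holomorphic_fibre|exact: holomorphic_lift].
Qed.

Lemma holomorphic_field_E : holomorphic U' FE.
Proof.
apply: (@holomorphic_eq _ _ _ _ (fun p => (hE p, 0))) => //.
  by move=> p _; rewrite field_EE.
apply: holomorphic_pair => //; [exact: holomorphic_hE|exact: holomorphic_cst].
Qed.

Lemma holomorphic_field_F : holomorphic U' FF.
Proof.
apply: (@holomorphic_eq _ _ _ _ (fun p => (hF p, 0))) => //.
  by move=> p _; rewrite field_FE.
apply: holomorphic_pair => //; [exact: holomorphic_hF|exact: holomorphic_cst].
Qed.

Lemma holomorphic_forms : [/\ holomorphic U' thl, holomorphic U' al & holomorphic U' be].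
Proof.
have [h1 h2 h3 h4 h5] := acf_coframe acf; split.
- exact: holomorphic_lift.
- apply: holomorphicB => //; first exact: holomorphic_lift.
  by apply: holomorphic_scaler => //; [exact: holomorphic_fibre|exact: holomorphic_lift].
- apply: holomorphicD => //; first exact: holomorphic_lift.
  by apply: holomorphic_scaler => //; [exact: holomorphic_fibre|exact: holomorphic_lift].
Qed.

Lemma hE_pairing p : U' p ->
  [/\ pairing (hE p) (a1 p.1) = 1, pairing (hE p) (a2 p.1) = p.2,
      pairing (hE p) (b1 p.1) = 0, pairing (hE p) (b2 p.1) = 0 &
      pairing (hE p) (th p.1) = 0].
Proof.
move=> Up; rewrite /hE !(pairingDl, pairingZl).
have [-> -> -> -> ->] := acf_e1 acf Up; have [-> -> -> -> ->] := acf_e2 acf Up.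
by rewrite !mulr0 mulr1 !addr0 add0r.
Qed.

Lemma hF_pairing p : U' p ->
  [/\ pairing (hF p) (a1 p.1) = 0, pairing (hF p) (a2 p.1) = 0,
      pairing (hF p) (b1 p.1) = p.2, pairing (hF p) (b2 p.1) = - 1 &
      pairing (hF p) (th p.1) = 0].
Proof.
move=> Up; rewrite /hF !(pairingDl, pairingZl, pairingNl).
have [-> -> -> -> ->] := acf_f1 acf Up; have [-> -> -> -> ->] := acf_f2 acf Up.
by rewrite !mulr0 mulr1 !subr0 add0r.
Qed.

Lemma al_pairing w p : pairing w.1 (al p) = pairing w.1 (a2 p.1) - p.2 * pairing w.1 (a1 p.1).
Proof. by rewrite /al pairingDr pairingNr pairingZr. Qed.

Lemma be_pairing w p : pairing w.1 (be p) = pairing w.1 (b1 p.1) + p.2 * pairing w.1 (b2 p.1).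
Proof. by rewrite /be pairingDr pairingZr. Qed.

Lemma mem_lift_D2 p w : U' p -> w \in LD2 p <-> pairing w.1 (thl p) = 0.
Proof. by move=> Up; rewrite -memv_preim lfunE; exact: (mem_C acf). Qed.

Lemma mem_lift_D p w :
  w \in LD p <-> exists x y, w = x *: FE p + y *: FF p + w.2 *: dd p.
Proof.
rewrite -memv_preim lfunE /= /line_E /line_F; split.
  move=> /memv_addP[_ /vlineP[x ->] [_ /vlineP[y ->] wE]]; exists x, y.
  rewrite field_EE field_FE scale_ddt [LHS]surjective_pairing wE.
  by congr (_, _) => /=; rewrite ?addr0 // !scaler0 !add0r.
move=> [x [y ->]]; rewrite field_EE field_FE scale_ddt /= addr0.
by apply: memv_add; rewrite memvZ // memv_line.
Qed.

Lemma mem_lift_DP p w : U' p -> w \in LD p <->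
  [/\ pairing w.1 (thl p) = 0, pairing w.1 (al p) = 0 & pairing w.1 (be p) = 0].
Proof.
move=> Up; split.
  move=> /(mem_lift_D _ _)[x [y ->]].
  rewrite al_pairing be_pairing /thl field_EE field_FE scale_ddt /= addr0.
  move: (hE p) (hF p) (hE_pairing Up) (hF_pairing Up) => u v.
  move=> [u1 u2 u3 u4 u5] [v1 v2 v3 v4 v5]; rewrite !(pairingDl, pairingZl).
  rewrite u1 u2 u3 u4 u5 v1 v2 v3 v4 v5; move: (p.2) => t {u1 u2 u3 u4 u5 v1 v2 v3 v4 v5}.
  by split; ring.
rewrite al_pairing be_pairing => -[w0 /eqP]; rewrite subr_eq0 => /eqP wa /eqP.
rewrite addr_eq0 => /eqP wb; apply/(mem_lift_D _ _).
(* The coefficients are read off where the generators are constant: [hE] has [e^1]-coordinate 1 and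
   [hF] has [f^2]-coordinate -1. The vanishing of [al] and [be] fixes the other two coordinates. *)
exists (pairing w.1 (a1 p.1)), (- pairing w.1 (b2 p.1)).
rewrite [LHS]surjective_pairing {1}(acf_expand acf Up w0) wa wb field_EE field_FE scale_ddt.
congr (_, _) => /=; last by rewrite !scaler0 !add0r.
  rewrite addr0 /hE /hF scalerDr scalerBr !scalerA mulNr -scaleNr opprK.
  by rewrite !addrA mulrC (mulrC p.2).
Qed.

Lemma lift_DE p : LD p = <<[:: FE p; FF p; dd p]>>%VS.
Proof.
apply/vspaceP => w; apply/idP/idP.
  move=> /(mem_lift_D _ _)[x [y ->]].
  by rewrite !rpredD ?rpredZ ?memv_span ?inE ?eqxx ?orbT.
rewrite !span_cons span_nil addv0.
move=> /memv_addP[_ /vlineP[x ->] [_ /memv_addP[_ /vlineP[y ->] [_ /vlineP[z ->] ->]] ->]].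
apply/(mem_lift_D _ _); exists x, y; rewrite addrA; congr (_ + _ *: _).
by rewrite field_EE field_FE scale_ddt /= !scaler0 !add0r.
Qed.

Lemma derive_hE p w : U' p ->
  'D_w hE p = 'D_(w.1) e1 p.1 + p.2 *: 'D_(w.1) e2 p.1 + w.2 *: e2 p.1.
Proof.
move=> Up; have [h1 h2 _ _] := acf_frame acf.
have d1 := holomorphic_differentiable h1 Up.
have d2 := holomorphic_differentiable h2 Up.
have ds := holomorphic_differentiable (holomorphic_fibre oU) Up.
have dl2 : differentiable (fun q : P => e2 q.1) p := differentiable_lift d2.
rewrite (deriveD (diff_derivable (differentiable_lift d1))
  (diff_derivable (differentiable_scaler ds dl2))).
rewrite (derive_scaler _ ds dl2) (derive_lift _ d1) (derive_lift _ d2) derive_sndE.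
by rewrite -addrA (addrC (w.2 *: _)).
Qed.

Lemma derive_hF p w : U' p ->
  'D_w hF p = p.2 *: 'D_(w.1) f1 p.1 - 'D_(w.1) f2 p.1 + w.2 *: f1 p.1.
Proof.
move=> Up; have [_ _ h1 h2] := acf_frame acf.
have d1 := holomorphic_differentiable h1 Up.
have d2 := holomorphic_differentiable h2 Up.
have ds := holomorphic_differentiable (holomorphic_fibre oU) Up.
have dl1 : differentiable (fun q : P => f1 q.1) p := differentiable_lift d1.
rewrite (deriveB (diff_derivable (differentiable_scaler ds dl1))
  (diff_derivable (differentiable_lift d2))).
rewrite (derive_scaler _ ds dl1) (derive_lift _ d1) (derive_lift _ d2) derive_sndE.
by rewrite -addrA addrC.
Qed.

Lemma field_S1 p : U' p -> (FS p).1 = 'D_(FE p) hF p - 'D_(FF p) hE p.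
Proof.
move=> Up; rewrite /field_S lie_fst.
- by congr (_ - _); congr ('D_ _ _ _); apply/funext => q; rewrite ?field_EE ?field_FE.
- exact: holomorphic_differentiable holomorphic_field_E Up.
- exact: holomorphic_differentiable holomorphic_field_F Up.
Qed.

(** Both fields have zero [t]-component, so [t] behaves as a constant and the bracket expands
    bilinearly. The grouping matters: [[e1, f1]] and [[e2, f2]] do not lie in C, but their
    difference does, hence so does S. *)
Lemma field_S_quadratic p : U' p -> (FS p).1 =
  - lie e1 f2 p.1 + p.2 *: (lie e1 f1 p.1 - lie e2 f2 p.1) + p.2 ^+ 2 *: lie e2 f1 p.1.
Proof.
move=> Up; rewrite field_S1 // derive_hE // derive_hF // field_EE field_FE /= !scale0r !addr0.
have [h1 h2 h3 h4] := acf_frame acf.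
rewrite /hE /hF /lie.
rewrite !(deriveDdir _ _ (holomorphic_differentiable h1 Up),
  deriveDdir _ _ (holomorphic_differentiable h2 Up),
  deriveDdir _ _ (holomorphic_differentiable h3 Up),
  deriveDdir _ _ (holomorphic_differentiable h4 Up),
  deriveZdir _ _ (holomorphic_differentiable h1 Up),
  deriveZdir _ _ (holomorphic_differentiable h2 Up),
  deriveZdir _ _ (holomorphic_differentiable h3 Up),
  deriveZdir _ _ (holomorphic_differentiable h4 Up),
  deriveNdir _ (holomorphic_differentiable h1 Up),
  deriveNdir _ (holomorphic_differentiable h2 Up),
  deriveNdir _ (holomorphic_differentiable h3 Up),
  deriveNdir _ (holomorphic_differentiable h4 Up)).
move: ('D_(e1 p.1) f1 p.1) ('D_(e2 p.1) f1 p.1) ('D_(e1 p.1) f2 p.1)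
  ('D_(e2 p.1) f2 p.1) ('D_(f1 p.1) e1 p.1) ('D_(f2 p.1) e1 p.1)
  ('D_(f1 p.1) e2 p.1) ('D_(f2 p.1) e2 p.1) => k1 k2 k3 k4 k5 k6 k7 k8.
apply/rowP => j; rewrite !mxE.
move: (p.2) (k1 0 j) (k2 0 j) (k3 0 j) (k4 0 j) (k5 0 j) (k6 0 j) (k7 0 j) (k8 0 j).
move=> t {k1 k2 k3 k4 k5 k6 k7 k8} k1 k2 k3 k4 k5 k6 k7 k8; ring.
Qed.

Lemma field_S_th p : U' p -> pairing (FS p).1 (th p.1) = 0.
Proof.
move=> Up; rewrite (field_S_quadratic Up).
move: (lie e1 f2 p.1) (lie e1 f1 p.1) (lie e2 f2 p.1) (lie e2 f1 p.1)
  (acf_e1f2 acf Up) (acf_e1f1 acf Up) (acf_e2f2 acf Up) (acf_e2f1 acf Up).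
move=> u1 u2 u3 u4 v1 v2 v3 v4.
rewrite !(pairingDl, pairingZl, pairingNl) v1 v2 v3 v4.
by rewrite subrr !mulr0 oppr0 !addr0.
Qed.

Lemma coframe_S p : U' p ->
  [/\ e1_S e1 e2 f1 f2 p = pairing (FS p).1 (a1 p.1),
      e2_S e1 e2 f1 f2 p = pairing (FS p).1 (a2 p.1),
      f1_S e1 e2 f1 f2 p = pairing (FS p).1 (b1 p.1) &
      f2_S e1 e2 f1 f2 p = pairing (FS p).1 (b2 p.1)].
Proof. by move=> Up; have := coframeE acf Up (field_S_th Up). Qed.

(** [A1] and [A2] are, up to sign, the values on S of the two forms that cut D out of D2; in this
    shape they arise as values of [dform]. *)
Lemma A1E p : U' p -> aA1 p = - pairing (FS p).1 (be p).
Proof. by move=> Up; rewrite /A1; have [_ _ -> ->] := coframe_S Up; rewrite be_pairing. Qed.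

Lemma A2E p : U' p -> aA2 p = pairing (FS p).1 (al p).
Proof. by move=> Up; rewrite /A2; have [-> -> _ _] := coframe_S Up; rewrite al_pairing. Qed.

Lemma S_pairing_poly (c : H -> H) : holomorphic U c ->
  fibre_poly U 3 (fun p => pairing (FS p).1 (c p.1)).
Proof.
move=> hc; have [h1 h2 h3 h4] := acf_frame acf.
apply: (@fibre_poly_eq _ _ _ (fun p => - pairing (lie e1 f2 p.1) (c p.1) +
  pairing (lie e1 f1 p.1 - lie e2 f2 p.1) (c p.1) * p.2 +
  pairing (lie e2 f1 p.1) (c p.1) * p.2 ^+ 2)).
  move=> p Up; rewrite (field_S_quadratic Up).
  move: (lie e1 f2 p.1) (lie e1 f1 p.1) (lie e2 f2 p.1) (lie e2 f1 p.1) => u1 u2 u3 u4.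
  rewrite !(pairingDl, pairingZl, pairingNl).
  by rewrite (mulrC p.2) (mulrC (p.2 ^+ 2)).
apply: (fibre_poly_quadratic (U := U) (a := fun x => - pairing (lie e1 f2 x) (c x))
  (b := fun x => pairing (lie e1 f1 x - lie e2 f2 x) (c x))
  (c := fun x => pairing (lie e2 f1 x) (c x))).
- apply: holomorphicN => //; apply: holomorphic_pairing => //; exact: holomorphic_lie.
- apply: holomorphic_pairing => //; apply: holomorphicB => //; exact: holomorphic_lie.
- apply: holomorphic_pairing => //; exact: holomorphic_lie.
Qed.

Lemma coframe_S_poly :
  [/\ fibre_poly U 3 (e1_S e1 e2 f1 f2), fibre_poly U 3 (e2_S e1 e2 f1 f2),
      fibre_poly U 3 (f1_S e1 e2 f1 f2) & fibre_poly U 3 (f2_S e1 e2 f1 f2)].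
Proof.
have [h1 h2 h3 h4 _] := acf_coframe acf.
by split; [move: h1|move: h2|move: h3|move: h4] => /S_pairing_poly;
  apply: fibre_poly_eq => p /coframe_S[].
Qed.

Lemma A1_poly : fibre_poly U 4 aA1.
Proof.
have [_ _ h3 h4] := coframe_S_poly.
apply: (fibre_polyN oU); apply: (fibre_polyD oU (fibre_polyW h3)).
exact: fibre_polyX.
Qed.

Lemma A2_poly : fibre_poly U 4 aA2.
Proof.
have [h1 h2 _ _] := coframe_S_poly.
apply: (fibre_polyD oU (fibre_polyW h2)); apply: (fibre_polyN oU).
exact: fibre_polyX.
Qed.

Lemma ell1E p : l1 p = (hE p, aA1 p).
Proof.
rewrite /ell1 scale_ddt field_EE [LHS]surjective_pairing /=.
by rewrite addr0 add0r.
Qed.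

Lemma ell2E p : l2 p = (hF p, aA2 p).
Proof.
rewrite /ell2 scale_ddt field_FE [LHS]surjective_pairing /=.
by rewrite addr0 add0r.
Qed.

Lemma holomorphic_A1 : holomorphic U' aA1.
Proof. exact: holomorphic_fibre_poly A1_poly. Qed.

Lemma holomorphic_A2 : holomorphic U' aA2.
Proof. exact: holomorphic_fibre_poly A2_poly. Qed.

Lemma holomorphic_ell1 : holomorphic U' l1.
Proof.
rewrite (_ : l1 = fun p => (hE p, aA1 p)); last by apply/funext => p; exact: ell1E.
exact: holomorphic_pair oU' holomorphic_hE holomorphic_A1.
Qed.

Lemma holomorphic_ell2 : holomorphic U' l2.
Proof.
rewrite (_ : l2 = fun p => (hF p, aA2 p)); last by apply/funext => p; exact: ell2E.
exact: holomorphic_pair oU' holomorphic_hF holomorphic_A2.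
Qed.

Lemma derive_ell p w : U' p -> 
  'D_w hE p = 'D_(w.1, 0) hE p + w.2 *: e2 p.1 /\
  'D_w hF p = 'D_(w.1, 0) hF p + w.2 *: f1 p.1.
Proof.
by move=> Up; rewrite !derive_hE // !derive_hF //= !scale0r !addr0.
Qed.

(** The base component is [S + A1 f1 - A2 e2]. The choice of [A1] and [A2] makes
    [f1S + A1 = - t f2S] and [e2S - A2 = t e1S], so it becomes [e1S hE - f2S hF] and stays in D.
    Subtracting the vertical part [e1S A1 - f2S A2] leaves the products [e1S f1S] and [e2S f2S], as
    the terms in [t e1S f2S] cancel. *)
Lemma lie_ell p : U' p ->
  lie l1 l2 p = e1_S e1 e2 f1 f2 p *: l1 p - f2_S e1 e2 f1 f2 p *: l2 p +
    ('D_(l1 p) aA2 p - 'D_(l2 p) aA1 p + e1_S e1 e2 f1 f2 p * f1_S e1 e2 f1 f2 p +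
     e2_S e1 e2 f1 f2 p * f2_S e1 e2 f1 f2 p) *: dd p.
Proof.
move=> Up; have d1 := holomorphic_differentiable holomorphic_ell1 Up.
have d2 := holomorphic_differentiable holomorphic_ell2 Up.
have [cf1 cf2 cf3 cf4] := coframe_S Up.
have S1 := acf_expand acf Up (field_S_th Up); rewrite -cf1 -cf2 -cf3 -cf4 in S1.
have E1 : (fun q => (l1 q).1) = hE by apply/funext => q; rewrite ell1E.
have E2 : (fun q => (l2 q).1) = hF by apply/funext => q; rewrite ell2E.
have E3 : (fun q => (l1 q).2) = aA1 by apply/funext => q; rewrite ell1E.
have E4 : (fun q => (l2 q).2) = aA2 by apply/funext => q; rewrite ell2E.
rewrite [LHS]surjective_pairing (lie_fst d1 d2) (lie_snd d1 d2) E1 E2 E3 E4.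
rewrite scale_ddt [RHS]surjective_pairing.
have -> : 'D_(l1 p) hF p - 'D_(l2 p) hE p = e1_S e1 e2 f1 f2 p *: hE p - f2_S e1 e2 f1 f2 p *: hF p.
  have [_ ->] := derive_ell (l1 p) Up; have [-> _] := derive_ell (l2 p) Up.
  rewrite ell1E ell2E /=.
  have -> : 'D_(hE p, 0) hF p + aA1 p *: f1 p.1 - ('D_(hF p, 0) hE p + aA2 p *: e2 p.1) =
      (FS p).1 + aA1 p *: f1 p.1 - aA2 p *: e2 p.1.
    rewrite field_S1 // field_EE field_FE opprD !addrA; congr (_ - _).
    by rewrite addrAC.
  rewrite S1 /A1 /A2 /hE /hF; apply/rowP => j; rewrite !mxE.
  move: (e1_S _ _ _ _ p) (e2_S _ _ _ _ p) (f1_S _ _ _ _ p) (f2_S _ _ _ _ p) (p.2)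
    (e1 p.1 0 j) (e2 p.1 0 j) (f1 p.1 0 j) (f2 p.1 0 j) => k1 k2 k3 k4 t m1 m2 m3 m4.
  ring.
move: ('D_(l1 p) aA2 p) ('D_(l2 p) aA1 p) => D1 D2.
rewrite ell1E ell2E /=; congr (_, _); first by rewrite addr0.
rewrite /A1 /A2.
move: (e1_S _ _ _ _ p) (e2_S _ _ _ _ p) (f1_S _ _ _ _ p) (f2_S _ _ _ _ p) (p.2)
  => k1 k2 k3 k4 t.
rewrite -[k1 *: _]/(k1 * _) -[k4 *: _]/(k4 * _); ring.
Qed.

(** * The canonical fields *)

Lemma dform_thl p u v : U' p -> dform thl p u v = levi th p.1 u.1 v.1.
Proof.
move=> Up; have [_ _ _ _ hth] := acf_coframe acf.
have dth := holomorphic_differentiable hth Up.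
by rewrite /dform /levi !(derive_lift _ dth).
Qed.

(** D2 is the kernel of the pulled-back [th], whose differential ignores vertical directions; the
    condition descends to the Levi form of the base components. *)
Lemma lie_lift_D2 p (X Y : P -> P) : U' p -> differentiable X p -> differentiable Y p ->
  (\forall q \near p, X q \in LD2 q) -> (\forall q \near p, Y q \in LD2 q) ->
  lie X Y p \in LD2 p <-> levi th p.1 (X p).1 (Y p).1 = 0.
Proof.
move=> Up dX dY X2 Y2; have [hth _ _] := holomorphic_forms.
have nU : \forall q \near p, U' q by exact: nearU'.
have n0 (Z : P -> P) : (\forall q \near p, Z q \in LD2 q) ->
    \forall q \near p, pairing (Z q).1 (thl q) = 0.
  by move=> Z2; apply: filterS2 nU Z2 => q Uq; move/(mem_lift_D2 _ Uq).
have dth := holomorphic_differentiable hth Up.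
rewrite -dform_thl // -(lie_dform dth dX dY (n0 _ X2) (n0 _ Y2)).
exact: mem_lift_D2.
Qed.

Lemma lift_D_sub p : U' p -> (LD p <= LD2 p)%VS.
Proof.
move=> Up; apply/subvP => w /(mem_lift_DP _ Up)[w0 _ _].
by apply/(mem_lift_D2 _ Up).
Qed.

Lemma holomorphic_ddt (W : set P) : holomorphic W dd.
Proof. exact: holomorphic_cst. Qed.

Lemma ddt_neq0 p : dd p != 0.
Proof. by apply/eqP => -[] /eqP; rewrite oner_eq0. Qed.

Lemma ddt_lift_D p : dd p \in LD p.
Proof. by rewrite lift_DE memv_span // !inE eqxx !orbT. Qed.

Lemma near_open (W : set P) (Q : P -> Prop) p : open W -> W p ->
  (forall q, W q -> Q q) -> \forall q \near p, Q q.
Proof. by move=> oW Wp HQ; apply: filterS (open_nbhs_nbhs (conj oW Wp)) => q; exact: HQ. Qed.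

(** The right side is [x be(f) + y al(f)]: contracting [-dth] with the base parts of D returns the
    two forms that define D inside D2. *)
Lemma hEF_levi p x y (f : H) : U' p -> pairing f (th p.1) = 0 ->
  levi th p.1 (x *: hE p + y *: hF p) f =
  x * (pairing f (b1 p.1) + p.2 * pairing f (b2 p.1)) -
  y * (p.2 * pairing f (a1 p.1) - pairing f (a2 p.1)).
Proof.
move=> Up f0; move: (hE p) (hF p) (hE_pairing Up) (hF_pairing Up) => u v.
move=> [u1 u2 u3 u4 u5] [v1 v2 v3 v4 v5].
have uv0 : pairing (x *: u + y *: v) (th p.1) = 0.
  by rewrite pairingDl !pairingZl u5 v5 !mulr0 addr0.
rewrite (leviE acf Up uv0 f0) !pairingDl !pairingZl u1 u2 u3 u4 v1 v2 v3 v4.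
move: (p.2) (pairing f (a1 p.1)) (pairing f (a2 p.1)) (pairing f (b1 p.1))
  (pairing f (b2 p.1)) => t k1 k2 k3 k4; ring.
Qed.

(** Two test fields suffice. With [x hE + y hF] the base part of [X p], the lift of [f1] detects [x]
    and that of [e2] detects [y], because [be] and [al] respectively take the value 1 on them. *)
Lemma ddt_characteristic W X p : open W -> W `<=` U' -> holo_section W LD X ->
  (forall W' Y, open W' -> W' `<=` W -> holo_section W' LD2 Y ->
     tangent_to W' LD2 (lie X Y)) ->
  W p -> X p \in <[dd p]>%VS.
Proof.
move=> oW WU [hX tX] HX Wp; have Up := WU _ Wp.
have [h1 h2 h3 h4] := acf_frame acf.
have hW (Z : H -> H) : holomorphic U Z -> holomorphic W (fun q : P => (Z q.1, 0 : K)).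
  move=> hZ; apply: holomorphic_subset WU _; apply: holomorphic_pair => //.
    exact: holomorphic_lift.
  exact: holomorphic_cst.
have X2 : \forall q \near p, X q \in LD2 q.
  apply: near_open oW Wp _ => q Wq; apply: (subvP (lift_D_sub (WU _ Wq))); exact: tX.
have key (Z : H -> H) : holomorphic U Z -> (forall x, U x -> pairing (Z x) (th x) = 0) ->
    levi th p.1 (X p).1 (Z p.1) = 0.
  move=> hZ Z0; pose Z' (q : P) : P := (Z q.1, 0).
  have tZ q : W q -> Z' q \in LD2 q.
    by move=> Wq; apply/(mem_lift_D2 _ (WU _ Wq)); exact: Z0 (WU _ Wq).
  have := HX W Z' oW (fun _ => id) (conj (hW _ hZ) tZ) p Wp.
  move/(lie_lift_D2 Up (holomorphic_differentiable hX Wp)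
    (holomorphic_differentiable (hW _ hZ) Wp) X2 (near_open oW Wp tZ)).
  by [].
have k1 := key _ h3 (fun x Ux => let: And5 _ _ _ _ h := acf_f1 acf Ux in h).
have k2 := key _ h2 (fun x Ux => let: And5 _ _ _ _ h := acf_e2 acf Ux in h).
have [x [y XE]] := iffLR (mem_lift_D _ _) (tX p Wp).
have X1 : (X p).1 = x *: hE p + y *: hF p.
  by rewrite XE field_EE field_FE scale_ddt /= addr0.
move: k1 k2; rewrite X1.
have [u1 u2 u3 u4 u5] := acf_f1 acf Up; have [v1 v2 v3 v4 v5] := acf_e2 acf Up.
rewrite !hEF_levi // u1 u2 u3 u4 v1 v2 v3 v4 => xE yE.
have x0 : x = 0 by rewrite -xE; ring.
have y0 : y = 0 by rewrite -yE; ring.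
by rewrite XE x0 y0 !scale0r !add0r memvZ // memv_line.
Qed.

Lemma is_characteristic_ddt : is_characteristic U' LD LD2 (fun p => <[dd p]>%VS).
Proof.
split.
- by apply: distribution_line => // [|p _]; [exact: holomorphic_ddt|exact: ddt_neq0].
- by move=> p Up; rewrite -memvE ddt_lift_D.
move=> W X oW WU sX; split; last by move=> h p; exact: ddt_characteristic h.
have [hX tX] := sX.
move=> dX W' Y oW' WW' [hY tY] p Wp; have Up := WU _ (WW' _ Wp).
have X2 : \forall q \near p, X q \in LD2 q.
  apply: near_open oW' Wp _ => q /WW' Wq.
  by apply: (subvP (lift_D_sub (WU _ Wq))); exact: tX.
apply/(lie_lift_D2 Up (holomorphic_differentiable hX (WW' _ Wp))
  (holomorphic_differentiable hY Wp) X2 (near_open oW' Wp tY)).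
have /vlineP[k ->] := dX p (WW' _ Wp).
rewrite scale_ddt /levi pairing0l derive0 pairing0r subrr //.
Qed.

Lemma hEF_coord p k l : U' p ->
  pairing (k *: hE p + l *: hF p) (a1 p.1) = k /\
  pairing (k *: hE p + l *: hF p) (b2 p.1) = - l.
Proof.
move=> Up; move: (hE p) (hF p) (hE_pairing Up) (hF_pairing Up) => u v.
move=> [u1 u2 u3 u4 u5] [v1 v2 v3 v4 v5].
by rewrite !pairingDl !pairingZl u1 u4 v1 v4; split; ring.
Qed.

Lemma ell_comb p k l :
  k *: l1 p + l *: l2 p = (k *: hE p + l *: hF p, k * aA1 p + l * aA2 p).
Proof. by rewrite ell1E ell2E. Qed.

Lemma ell_free p : U' p -> free [:: l1 p; l2 p].
Proof.
move=> Up; apply/free2P => k l; rewrite ell_comb => -[kl _].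
have [] := hEF_coord k l Up; rewrite kl !pairing0l => <- /eqP.
by rewrite eq_sym oppr_eq0 => /eqP.
Qed.

Lemma ell1_neq0 p : U' p -> l1 p != 0.
Proof.
move=> Up; apply/eqP => l0; have /free2P/(_ 1 0) := ell_free Up.
by rewrite l0 scaler0 scale0r addr0 => /(_ erefl)[/eqP]; rewrite oner_eq0.
Qed.

Lemma ell2_neq0 p : U' p -> l2 p != 0.
Proof.
move=> Up; apply/eqP => l0; have /free2P/(_ 0 1) := ell_free Up.
by rewrite l0 scaler0 scale0r addr0 => /(_ erefl)[_ /eqP]; rewrite oner_eq0.
Qed.

Lemma ell_comb_D p k l : k *: l1 p + l *: l2 p \in LD p.
Proof.
apply/(mem_lift_D _ _); exists k, l.
rewrite ell_comb scale_ddt field_EE field_FE /=.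
by rewrite [RHS]surjective_pairing /= addr0 !scaler0 !add0r.
Qed.

Lemma ell1_D p : l1 p \in LD p.
Proof. by have := ell_comb_D p 1 0; rewrite scale1r scale0r addr0. Qed.

Lemma ell2_D p : l2 p \in LD p.
Proof. by have := ell_comb_D p 0 1; rewrite scale1r scale0r add0r. Qed.

Lemma lie_ell_D p : U' p -> lie l1 l2 p \in LD p.
Proof.
move=> Up; rewrite (lie_ell Up) -scaleNr.
by apply: memvD; [exact: ell_comb_D|rewrite memvZ ?ddt_lift_D].
Qed.

(** For each [c] among [thl], [al], [be], the form [-dc] on the plane is a minor times
    [c([l1, l2])], which vanishes because [lie_ell] puts that bracket in D. *)
Lemma is_sqrt_ell : is_sqrt U' LD (fun p => <<[:: l1 p; l2 p]>>%VS).
Proof.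
split.
- apply: distribution_plane => //; [exact: holomorphic_ell1|exact: holomorphic_ell2|].
  exact: ell_free.
- move=> p Up; apply/subvP => w /mem_span2[k [l ->]]; exact: ell_comb_D.
move=> W X Y oW WU [hX tX] [hY tY] p Wp; have Up := WU _ Wp.
have [hth hal hbe] := holomorphic_forms.
have key c : holomorphic U' c ->
    (forall q, U' q -> forall w, w \in LD q -> pairing w.1 (c q) = 0) ->
    pairing (lie X Y p).1 (c p) = 0.
  move=> hc c0; have dc := holomorphic_differentiable hc Up.
  have tD (Z : P -> P) : tangent_to W (fun q => <<[:: l1 q; l2 q]>>%VS) Z ->
      \forall q \near p, pairing (Z q).1 (c q) = 0.
    move=> tZ; apply: near_open oW Wp _ => q Wq; apply: c0; first exact: WU.
    have /mem_span2[k [l ->]] := tZ q Wq; apply: ell_comb_D.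
  rewrite (lie_dform dc (holomorphic_differentiable hX Wp)
    (holomorphic_differentiable hY Wp) (tD _ tX) (tD _ tY)).
  have /mem_span2[x1 [x2 ->]] := tX p Wp.
  have /mem_span2[y1 [y2 ->]] := tY p Wp.
  rewrite (dform_minor (l1 p) (l2 p) x1 x2 y1 y2 dc).
  rewrite -(lie_dform dc (holomorphic_differentiable holomorphic_ell1 Up)
    (holomorphic_differentiable holomorphic_ell2 Up)).
  - by rewrite (c0 p Up _ (lie_ell_D Up)) mulr0.
  - by apply: nearU' => // q Uq; apply: c0 => //; exact: ell1_D.
  - by apply: nearU' => // q Uq; apply: c0 => //; exact: ell2_D.
apply/(mem_lift_DP _ Up); split; apply: key => // q Uq w /(mem_lift_DP _ Uq)[] //.
Qed.

(* A vertical derivative does not see the variation of c along the base. *)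
Lemma vertical_pairing (X : P -> H) (c : H -> H) p k : U' p -> differentiable X p ->
  differentiable c p.1 -> (\forall q \near p, pairing (X q) (c q.1) = 0) ->
  pairing ('D_(0, k) X p) (c p.1) = 0.
Proof.
move=> Up dX dc X0.
have dl : differentiable (fun q : P => c q.1) p := differentiable_lift dc.
have /eqP : pairing ('D_(0, k) X p) (c p.1) + pairing (X p) ('D_(0, k) (fun q : P => c q.1) p) = 0.
  rewrite -(derive_pairing _ dX dl).
  by rewrite (near_eq_derive (g := fun=> 0)) // derive_cst.
by rewrite (derive_lift _ dc) derive0 pairing0r addr0 => /eqP.
Qed.

(** The base component of [v] vanishes near the point, so only the derivative of the base component
    of [X] along the fibre survives. *)
Lemma lie_vertical W (v X : P -> P) p : open W -> W `<=` U' ->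
  holo_section W (fun q => <[dd q]>%VS) v -> holomorphic W X -> W p ->
  (lie v X p).1 = 'D_(0, (v p).2) (fun q => (X q).1) p.
Proof.
move=> oW WU [hv tv] hX Wp.
have v1 q : W q -> (v q).1 = 0.
  by move=> /tv /vlineP[k ->]; rewrite scale_ddt.
rewrite (lie_fst (holomorphic_differentiable hv Wp) (holomorphic_differentiable hX Wp)).
rewrite (near_eq_derive (f := fun q => (v q).1) (g := fun=> 0)); last first.
  exact: near_open oW Wp v1.
by rewrite derive_cst subr0 [v p in LHS]surjective_pairing v1.
Qed.

(** The common kernel of [th], [c], [d] is a subspace of the base that does not depend on [t].
    Vertical differentiation preserves it, so [X] and [[v, X]] both have base parts in it, and its
    isotropy puts [[X, [v, X]]] in D2. *)
Lemma null_line_of_isotropic (l : P -> P) (c d : H -> H) :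
  holomorphic U' l -> holomorphic U c -> holomorphic U d ->
  (forall p, U' p -> l p != 0) ->
  (forall p, U' p -> l p \in <<[:: l1 p; l2 p]>>%VS) ->
  (forall p, U' p -> pairing (l p).1 (c p.1) = 0 /\ pairing (l p).1 (d p.1) = 0) ->
  (forall x u v, U x -> pairing u (th x) = 0 -> pairing v (th x) = 0 ->
     pairing u (c x) = 0 -> pairing v (c x) = 0 ->
     pairing u (d x) = 0 -> pairing v (d x) = 0 -> levi th x u v = 0) ->
  is_null_line U' LD2 (fun p => <[dd p]>%VS) (fun p => <<[:: l1 p; l2 p]>>%VS)
    (fun p => <[l p]>%VS).
Proof.
move=> hl hc hd l0 lQ lcd iso; split.
- exact: distribution_line.
- by move=> p Up; rewrite -memvE lQ.
move=> W v X oW WU sv [hX tX] p Wp; have Up := WU _ Wp.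
have [hv tv] := sv.
have hZ : holomorphic W (lie v X) by exact: holomorphic_lie_lift.
have [_ _ _ _ hth] := acf_coframe acf.
have lth q : U' q -> pairing (l q).1 (th q.1) = 0.
  move=> Uq; have /mem_span2[x [y ->]] := lQ q Uq.
  by have /(mem_lift_DP _ Uq)[] := ell_comb_D q x y.
have van (e : H -> H) : holomorphic U e -> (forall q, U' q -> pairing (l q).1 (e q.1) = 0) ->
    forall q, W q -> pairing (X q).1 (e q.1) = 0 /\ pairing (lie v X q).1 (e q.1) = 0.
  move=> he le q Wq; have Uq := WU _ Wq.
  have Xe r : W r -> pairing (X r).1 (e r.1) = 0.
    by move=> Wr; have /vlineP[k ->] := tX r Wr; rewrite /= pairingZl le ?mulr0 //; exact: WU.
  split; first exact: Xe.
  rewrite (lie_vertical oW WU sv hX Wq); apply: vertical_pairing => //.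
  - exact: differentiable_fst (holomorphic_differentiable hX Wq).
  - exact: holomorphic_differentiable he Uq.
  - exact: near_open oW Wq Xe.
have vth := van th hth lth.
have vc := van c hc (fun q Uq => (lcd q Uq).1).
have vd := van d hd (fun q Uq => (lcd q Uq).2).
rewrite /bracket_form.
apply/(lie_lift_D2 Up (holomorphic_differentiable hX Wp) (holomorphic_differentiable hZ Wp)).
- by apply: near_open oW Wp _ => q Wq; apply/(mem_lift_D2 _ (WU _ Wq)); have [] := vth q Wq.
- by apply: near_open oW Wp _ => q Wq; apply/(mem_lift_D2 _ (WU _ Wq)); have [] := vth q Wq.
by apply: iso => //; [have [] := vth p Wp|have [] := vth p Wp|have [] := vc p Wp
  |have [] := vc p Wp|have [] := vd p Wp|have [] := vd p Wp].
Qed.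

(** The isotropic subspace is E, cut out of C by [b1] and [b2]; for the second line it is F, cut out
    by [a1] and [a2]. *)
Lemma is_null_line_ell1 : is_null_line U' LD2 (fun p => <[dd p]>%VS)
  (fun p => <<[:: l1 p; l2 p]>>%VS) (fun p => <[l1 p]>%VS).
Proof.
have [_ _ h3 h4 _] := acf_coframe acf.
apply: (null_line_of_isotropic holomorphic_ell1 h3 h4 ell1_neq0).
- by move=> p _; rewrite memv_span ?mem_head.
- by move=> p Up; rewrite ell1E; have [] := hE_pairing Up.
move=> x u v Ux u0 v0 u1 v1 u2 v2.
by rewrite (leviE acf Ux u0 v0) u1 v1 u2 v2 !mul0r !mulr0 subrr addr0.
Qed.

Lemma is_null_line_ell2 : is_null_line U' LD2 (fun p => <[dd p]>%VS)
  (fun p => <<[:: l1 p; l2 p]>>%VS) (fun p => <[l2 p]>%VS).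
Proof.
have [h1 h2 _ _ _] := acf_coframe acf.
apply: (null_line_of_isotropic holomorphic_ell2 h1 h2 ell2_neq0).
- by move=> p _; rewrite memv_span // !inE eqxx orbT.
- by move=> p Up; rewrite ell2E; have [] := hF_pairing Up.
move=> x u v Ux u0 v0 u1 v1 u2 v2.
by rewrite (leviE acf Ux u0 v0) u1 v1 u2 v2 !mul0r !mulr0 subrr addr0.
Qed.

Lemma canonical_fields_ell : canonical_fields U' LD LD2 (fun p => <[dd p]>%VS)
  (fun p => <<[:: l1 p; l2 p]>>%VS) (fun p => <[l1 p]>%VS) (fun p => <[l2 p]>%VS).
Proof.
split; [exact: is_characteristic_ddt|exact: is_sqrt_ell|exact: is_null_line_ell1
  |exact: is_null_line_ell2|].
by move=> p _; rewrite span_cons span_seq1.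
Qed.

(** A local generator of [VV] satisfies the bracket condition, hence is vertical at [p], and a
    nonzero vector of a line spans it. *)
Lemma characteristic_unique VV p : is_characteristic U' LD LD2 VV -> U' p ->
  VV p = <[dd p]>%VS.
Proof.
move=> [dV VD VP] Up.
have [W [X [oW Wp WU hX XV]]] := distribution_line_frame dV Up.
have tX : tangent_to W VV X.
  by move=> q Wq; have [-> _] := XV q Wq; exact: memv_line.
have sX : holo_section W LD X.
  by split=> // q Wq; apply: (subvP (VD _ (WU _ Wq))); exact: tX.
have XD := ddt_characteristic oW WU sX ((VP _ _ oW WU sX).1 tX) Wp.
by have [-> X0] := XV p Wp; exact: vline_eq.
Qed.

(** These values are the matrix of the bracket from the second exterior power of D to D2/D, read
    through [al] and [be]. The column of [FE], [FF] comes from S; the columns with [dd] come from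
    [d_t al = - a1] and [d_t be = b2]. *)
Lemma dform_al_be p : U' p ->
  [/\ dform al p (FE p) (FF p) = aA2 p, dform al p (FE p) (dd p) = -1,
      dform al p (FF p) (dd p) = 0 & 
  [/\ dform be p (FE p) (FF p) = - aA1 p, dform be p (FE p) (dd p) = 0 &
      dform be p (FF p) (dd p) = -1]].
Proof.
move=> Up; have [_ hal hbe] := holomorphic_forms.
have dal := holomorphic_differentiable hal Up.
have dbe := holomorphic_differentiable hbe Up.
have dE := holomorphic_differentiable holomorphic_field_E Up.
have dF := holomorphic_differentiable holomorphic_field_F Up.
have [h1 h2 h3 h4 _] := acf_coframe acf.
have d1 := holomorphic_differentiable h1 Up.
have d2 := holomorphic_differentiable h2 Up.
have d3 := holomorphic_differentiable h3 Up.
have d4 := holomorphic_differentiable h4 Up.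
have ds := holomorphic_differentiable (holomorphic_fibre oU) Up.
have sc (c : H -> H) : differentiable c p.1 ->
    'D_(dd p) (fun q : P => q.2 *: c q.1) p = c p.1.
  move=> dc; have dl : differentiable (fun q : P => c q.1) p := differentiable_lift dc.
  by rewrite (derive_scaler _ ds dl) derive_sndE (derive_lift _ dc) derive0 scaler0 addr0 scale1r.
have ds' (c : H -> H) : differentiable c p.1 ->
    derivable (fun q : P => q.2 *: c q.1) p (dd p).
  move=> dc; apply: diff_derivable; apply: differentiable_scaler => //.
  exact: differentiable_lift.
have dl' (c : H -> H) : differentiable c p.1 -> derivable (fun q : P => c q.1) p (dd p).
  by move=> dc; apply: diff_derivable; exact: differentiable_lift.
have Dal : 'D_(dd p) al p = - a1 p.1.
  rewrite (deriveB (dl' _ d2) (ds' _ d1)) (sc _ d1) (derive_lift _ d2) derive0.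
  exact: add0r.
have Dbe : 'D_(dd p) be p = b2 p.1.
  by rewrite (deriveD (dl' _ d3) (ds' _ d4)) (sc _ d4) (derive_lift _ d3) derive0 add0r.
have nE c : 
    (forall q, U' q -> forall w, w \in LD q -> pairing w.1 (c q) = 0) ->
    \forall q \near p, pairing (FE q).1 (c q) = 0.
  move=> c0; apply: nearU' => // q Uq; apply: (c0 q Uq).
  by rewrite lift_DE memv_span ?mem_head.
have nF c : 
    (forall q, U' q -> forall w, w \in LD q -> pairing w.1 (c q) = 0) ->
    \forall q \near p, pairing (FF q).1 (c q) = 0.
  move=> c0; apply: nearU' => // q Uq; apply: (c0 q Uq).
  by rewrite lift_DE memv_span // !inE eqxx orbT.
have al0 q : U' q -> forall w, w \in LD q -> pairing w.1 (al q) = 0.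
  by move=> Uq w /(mem_lift_DP _ Uq)[].
have be0 q : U' q -> forall w, w \in LD q -> pairing w.1 (be q) = 0.
  by move=> Uq w /(mem_lift_DP _ Uq)[].
have dform_dd c X : X.2 = 0 -> dform c p X (dd p) = pairing X.1 ('D_(dd p) c p).
  by move=> _; rewrite /dform pairing0l subr0.
rewrite !dform_dd ?field_EE ?field_FE //= Dal Dbe -!field_EE -!field_FE.
rewrite !pairingNr.
have [-> _ _ -> _] := hE_pairing Up; have [-> _ _ -> _] := hF_pairing Up.
rewrite oppr0 A1E // A2E // opprK; split=> //.
  by rewrite -(lie_dform dal dE dF (nE _ al0) (nF _ al0)).
by split=> //; rewrite -(lie_dform dbe dE dF (nE _ be0) (nF _ be0)).
Qed.

(* The bracket maps the rank 3 bundle /\^2 D onto D2 / D, of rank 2, so its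
   kernel is a line, spanned by l1 /\ l2. *)
Lemma sqrt_unique Q p : is_sqrt U' LD Q -> U' p -> Q p = <<[:: l1 p; l2 p]>>%VS.
Proof.
move=> [dQ QD QP] Up.
have [W [X [Y [oW Wp WU [hX hY] XYQ]]]] := distribution_plane_frame dQ Up.
have [QE frXY] := XYQ p Wp.
have sX : holo_section W Q X.
  by split=> // q Wq; have [-> _] := XYQ q Wq; rewrite memv_span ?mem_head.
have sY : holo_section W Q Y.
  by split=> // q Wq; have [-> _] := XYQ q Wq; rewrite memv_span // !inE eqxx orbT.
have XD q : W q -> X q \in LD q.
  by move=> Wq; apply: (subvP (QD _ (WU _ Wq))); exact: sX.2.
have YD q : W q -> Y q \in LD q.
  by move=> Wq; apply: (subvP (QD _ (WU _ Wq))); exact: sY.2.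
have [_ hal hbe] := holomorphic_forms.
have dX := holomorphic_differentiable hX Wp.
have dY := holomorphic_differentiable hY Wp.
have key c : holomorphic U' c ->
    (forall q, U' q -> forall w, w \in LD q -> pairing w.1 (c q) = 0) ->
    dform c p (X p) (Y p) = 0.
  move=> hc c0; have dc := holomorphic_differentiable hc Up.
  rewrite -(lie_dform dc dX dY).
  - exact: c0 Up _ (QP W X Y oW WU sX sY p Wp).
  - by apply: near_open oW Wp _ => q Wq; apply: c0; [exact: WU|exact: XD].
  - by apply: near_open oW Wp _ => q Wq; apply: c0; [exact: WU|exact: YD].
have kal := key al hal (fun q Uq w wD => let: And3 _ h _ := iffLR (mem_lift_DP w Uq) wD in h).
have kbe := key be hbe (fun q Uq w wD => let: And3 _ _ h := iffLR (mem_lift_DP w Uq) wD in h).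
have [x1 [x2 XE]] := iffLR (mem_lift_D _ _) (XD p Wp).
have [y1 [y2 YE]] := iffLR (mem_lift_D _ _) (YD p Wp).
move: (X p).2 (Y p).2 XE YE => x3 y3 XE YE.
rewrite XE YE (dform_minors _ _ _ _ _ _ _ _ _ (holomorphic_differentiable hal Up)) in kal.
rewrite XE YE (dform_minors _ _ _ _ _ _ _ _ _ (holomorphic_differentiable hbe Up)) in kbe.
have [q1 q2 q3 [r1 r2 r3]] := dform_al_be Up.
rewrite q1 q2 q3 in kal; rewrite r1 r2 r3 in kbe.
rewrite XE YE in frXY QE; have nm := free2_minors frXY.
(* The two equations express the minors involving [dd] through the remaining one. That one is
   nonzero, since otherwise all three would vanish and the frame would not be free. *)
have m13 : x1 * y3 - x3 * y1 = (x1 * y2 - x2 * y1) * aA2 p.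
  by apply/eqP; rewrite -subr_eq0 -oppr_eq0 -kal; apply/eqP; ring.
have m23 : x2 * y3 - x3 * y2 = - (x1 * y2 - x2 * y1) * aA1 p.
  by apply/eqP; rewrite -subr_eq0 -oppr_eq0 -kbe; apply/eqP; ring.
have m12 : x1 * y2 - x2 * y1 != 0.
  by apply/eqP => m0; apply: nm; rewrite m13 m23 m0 oppr0 !mul0r.
(* A 3 by 3 determinant with a repeated row vanishes; expanding it writes [m12 x3] in the other two
   minors. The same identity is used for [y3]. *)
have cX : x3 = x1 * aA1 p + x2 * aA2 p.
  apply: (mulfI m12).
  have -> : (x1 * y2 - x2 * y1) * x3 = x2 * (x1 * y3 - x3 * y1) - x1 * (x2 * y3 - x3 * y2) by ring.
  by rewrite m13 m23; ring.
have cY : y3 = y1 * aA1 p + y2 * aA2 p.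
  apply: (mulfI m12).
  have -> : (x1 * y2 - x2 * y1) * y3 = y2 * (x1 * y3 - x3 * y1) - y1 * (x2 * y3 - x3 * y2) by ring.
  by rewrite m13 m23; ring.
have comb z1 z2 : z1 *: FE p + z2 *: FF p + (z1 * aA1 p + z2 * aA2 p) *: dd p =
    z1 *: l1 p + z2 *: l2 p.
  rewrite ell_comb scale_ddt field_EE field_FE [LHS]surjective_pairing /=.
  by rewrite addr0 !scaler0 !add0r.
move: QE; rewrite cX cY !comb in frXY * => QE; rewrite QE.
apply/eqP; rewrite eqEdim; apply/andP; split.
  by apply/span_subvP => w; rewrite !inE => /orP[] /eqP ->; apply/mem_span2; do 2!eexists.
have := ell_free Up; rewrite /free in frXY *.
by move: frXY => /eqP -> /eqP ->.
Qed.

(* For X = x l1 + y l2, the form [X, [dd, X]] modulo D2 is 2 x y. *)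
Lemma null_line_unique VV Q L p : is_characteristic U' LD LD2 VV ->
  is_sqrt U' LD Q -> is_null_line U' LD2 VV Q L -> U' p ->
  L p = <[l1 p]>%VS \/ L p = <[l2 p]>%VS.
Proof.
move=> cV sQ [dL LQ LP] Up.
have [W [X [oW Wp WU hX XL]]] := distribution_line_frame dL Up.
have tX : tangent_to W L X.
  by move=> q Wq; have [-> _] := XL q Wq; exact: memv_line.
have XQ q : W q -> X q \in <<[:: l1 q; l2 q]>>%VS.
  move=> Wq; rewrite -(sqrt_unique sQ (WU _ Wq)); apply: (subvP (LQ _ (WU _ Wq))).
  exact: tX.
have sv : holo_section W VV dd.
  split; first exact: holomorphic_ddt.
  by move=> q Wq; rewrite (characteristic_unique cV (WU _ Wq)) memv_line.
have sv' : holo_section W (fun q => <[dd q]>%VS) dd.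
  by split; [exact: holomorphic_ddt|move=> q _; exact: memv_line].
have := LP W dd X oW WU sv (conj hX tX) p Wp; rewrite /bracket_form.
have hZ : holomorphic W (lie dd X) by exact: holomorphic_lie_lift oW (holomorphic_ddt W) hX.
have [h1 h2 h3 h4 hth] := acf_coframe acf.
have XD q : W q -> X q \in LD q.
  by move=> Wq; have /mem_span2[k [l ->]] := XQ q Wq; exact: ell_comb_D.
have X2 q : W q -> X q \in LD2 q.
  by move=> Wq; apply: (subvP (lift_D_sub (WU _ Wq))); exact: XD.
have Z1 q : W q -> (lie dd X q).1 = 'D_(0, 1) (fun r => (X r).1) q.
  exact: lie_vertical oW WU sv' hX.
have Z2 q : W q -> lie dd X q \in LD2 q.
  move=> Wq; apply/(mem_lift_D2 _ (WU _ Wq)); rewrite Z1 //.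
  apply: vertical_pairing; first exact: WU.
  - exact: differentiable_fst (holomorphic_differentiable hX Wq).
  - exact: holomorphic_differentiable hth (WU _ Wq).
  by apply: near_open oW Wq _ => r Wr; apply/(mem_lift_D2 _ (WU _ Wr)); exact: X2.
move/(lie_lift_D2 Up (holomorphic_differentiable hX Wp) (holomorphic_differentiable hZ Wp)
  (near_open oW Wp X2) (near_open oW Wp Z2)).
have dX1 := differentiable_fst (holomorphic_differentiable hX Wp).
have [_ hal hbe] := holomorphic_forms.
have dal := holomorphic_differentiable hal Up.
have dbe := holomorphic_differentiable hbe Up.
have Zth := iffLR (mem_lift_D2 _ Up) (Z2 p Wp).
(* Here [c] depends on [t], so differentiating [c(X) = 0] along the fibre leaves a term in [d_t c],
   in contrast with [vertical_pairing]. *)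
have vert c : differentiable c p ->
    (forall q, U' q -> forall w, w \in LD q -> pairing w.1 (c q) = 0) ->
    pairing (lie dd X p).1 (c p) = - pairing (X p).1 ('D_(dd p) c p).
  move=> dc c0; rewrite Z1 //; apply/eqP; rewrite -addr_eq0; apply/eqP.
  rewrite -(derive_pairing _ dX1 dc).
  rewrite (near_eq_derive (g := fun=> 0)) ?derive_cst //.
  by apply: near_open oW Wp _ => q Wq; apply: c0; [exact: WU|exact: XD].
have va := vert al dal (fun q Uq w wD => let: And3 _ h _ := iffLR (mem_lift_DP w Uq) wD in h).
have vb := vert be dbe (fun q Uq w wD => let: And3 _ _ h := iffLR (mem_lift_DP w Uq) wD in h).
have /mem_span2[x [y XE]] := XQ p Wp.
have X1 : (X p).1 = x *: hE p + y *: hF p by rewrite XE ell_comb.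
have [q1 q2 q3 [r1 r2 r3]] := dform_al_be Up.
have dd0 c X' : dform c p X' (dd p) = pairing X'.1 ('D_(dd p) c p).
  by rewrite /dform pairing0l subr0.
rewrite !dd0 !field_EE !field_FE /= in q2 q3 r2 r3.
rewrite X1 (pairing_comb x y (hE p)) q2 q3 al_pairing in va.
rewrite X1 (pairing_comb x y (hE p)) r2 r3 be_pairing in vb.
rewrite X1 hEF_levi //.
(* Thus [be([dd, X]) = y] and, below, [al([dd, X]) = x]; both summands of [hEF_levi] then equal
   [x y]. *)
have -> : pairing (lie dd X p).1 (b1 p.1) + p.2 * pairing (lie dd X p).1 (b2 p.1) = y.
  by rewrite vb; ring.
have -> : p.2 * pairing (lie dd X p).1 (a1 p.1) - pairing (lie dd X p).1 (a2 p.1) = - x.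
  by rewrite -opprB va; ring.
(* Dividing by 2 is possible because a [numFieldType] has characteristic zero. *)
move=> xy; have {}xy : (2 * x) * y = 0 by rewrite -xy; ring.
have [-> X0] := XL p Wp; move/eqP: xy; rewrite !mulf_eq0 pnatr_eq0 /=.
case/orP => /eqP z0; [right|left]; apply: vline_eq => //; rewrite XE z0 scale0r ?add0r ?addr0;
  by rewrite memvZ // memv_line.
Qed.

(** Each null line is one of two candidates. They cannot coincide, since their sum has to be the
    plane [Q p], of dimension 2; this leaves the two orderings, possibly different from point to
    point. *)
Lemma canonical_fields_unique VV Q L1 L2 p : canonical_fields U' LD LD2 VV Q L1 L2 -> U' p ->
  [/\ VV p = <[dd p]>%VS, Q p = <<[:: l1 p; l2 p]>>%VS &
      (L1 p = <[l1 p]>%VS /\ L2 p = <[l2 p]>%VS) \/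
      (L1 p = <[l2 p]>%VS /\ L2 p = <[l1 p]>%VS)].
Proof.
move=> [cV sQ n1 n2 QE] Up; split; first exact: characteristic_unique.
  exact: sqrt_unique.
have := QE p Up; rewrite (sqrt_unique sQ Up).
have dim2 : \dim <<[:: l1 p; l2 p]>> = 2%N by apply/eqP; exact: ell_free.
have no u : <<[:: l1 p; l2 p]>>%VS <> (<[u]> + <[u]>)%VS.
  move=> h; have := dim2; rewrite h addvv dim_vline.
  by case: (u != 0).
by case: (null_line_unique cV sQ n1 Up) => ->;
  case: (null_line_unique cV sQ n2 Up) => -> //; [move/no|left|right|move/no].
Qed.

(** * The fibres of the lift and the quartic *)

Lemma lift_fibre_line x t : U x ->
  lift_fibre U E F x (line_E e1 e2 (x, t)) (line_F f1 f2 (x, t)).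
Proof.
move=> Ux; have Up : U' (x, t) by [].
rewrite /line_E /line_F -/(hE (x, t)) -/(hF (x, t)).
move: (hE _) (hF _) (hE_pairing Up) (hF_pairing Up)
  (fun k l f => hEF_levi k l (f := f) Up) => u v /=.
move=> [u1 u2 u3 u4 u5] [v1 v2 v3 v4 v5] lev.
split.
- rewrite dim_vline; case: eqP u1 => // ->; rewrite pairing0l => /eqP.
  by rewrite eq_sym oner_eq0.
- rewrite dim_vline; case: eqP v4 => // ->; rewrite pairing0l => /eqP.
  by rewrite eq_sym oppr_eq0 oner_eq0.
- by rewrite -memvE; apply/(mem_E acf _ Ux).
- by rewrite -memvE; apply/(mem_F acf _ Ux).
move=> _ _ /vlineP[k ->] /vlineP[l ->].
have k0 : pairing (k *: u) (th x) = 0 by rewrite pairingZl u5 mulr0.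
have l0 : pairing (l *: v) (th x) = 0 by rewrite pairingZl v5 mulr0.
apply/(levi_nullP acf Ux k0 l0).
have := lev k 0 (l *: v) l0; rewrite scale0r addr0 => ->.
by rewrite !pairingZl v1 v2 v3 v4; ring.
Qed.

Lemma dim1_line (V : vectType K) (L : {vspace V}) : \dim L = 1%N ->
  exists2 u, u != 0 & L = <[u]>%VS.
Proof.
move=> L1; have L0 : L != 0%VS by rewrite -dimv_eq0 L1.
exists (vpick L); first by rewrite vpick0.
apply/esym/eqP; rewrite eqEdim -memvE memv_pick dim_vline vpick0 L0.
by rewrite L1.
Qed.

(** The excluded line is the point [[0:1]] of the fibre. Elsewhere [u = a e1 + b e2] has [a]
    nonzero, so [t = b / a], and the Levi condition [a c + b d = 0] determines the line of
    [v = c f1 + d f2]. *)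
Lemma lift_fibre_chart x lE lF : U x -> lift_fibre U E F x lE lF ->
  lE <> <[e2 x]>%VS ->
  exists! t, lE = line_E e1 e2 (x, t) /\ lF = line_F f1 f2 (x, t).
Proof.
move=> Ux [/dim1_line[u u0 lEE] /dim1_line[v v0 lFE]].
rewrite {}lEE {}lFE -!memvE => /(mem_E acf _ Ux)[uth ub1 ub2] /(mem_F acf _ Ux)[vth va1 va2].
move=> /(_ u v (memv_line u) (memv_line v)) /(levi_nullP acf Ux uth vth).
rewrite (leviE acf Ux uth vth) ub1 ub2 va1 va2 !mul0r !subr0 => ann ne2.
have uE := acf_expand acf Ux uth; have vE := acf_expand acf Ux vth.
rewrite ub1 ub2 !scale0r !addr0 in uE; rewrite va1 va2 !scale0r !add0r in vE.
move: (pairing u (a1 x)) (pairing u (a2 x)) (pairing v (b1 x)) (pairing v (b2 x)) ann uE vE.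
move=> a b c d ann uE vE.
have a0 : a != 0.
  apply/eqP => a0; apply: ne2; apply: vline_eq => //.
  by rewrite uE a0 scale0r add0r memvZ // memv_line.
exists (b / a); split.
  split; apply: vline_eq => //=.
    rewrite uE; apply/vlineP; exists a.
    by rewrite scalerDr scalerA mulrCA divff // mulr1.
  (* The coefficient of [f2] in [t f1 - f2] is -1, which forces the factor [- d]. *)
  rewrite vE; apply/vlineP; exists (- d).
  rewrite scalerBr scalerA scaleNr opprK; congr (_ *: _ + _).
  apply: (mulfI a0); rewrite -[RHS]add0r -ann; field.
  exact: a0.
move=> t [tE _]; have Up : U' (x, t) by [].
have : u \in line_E e1 e2 (x, t) by rewrite -tE memv_line.
rewrite /line_E -/(hE (x, t)) => /vlineP[k]; rewrite uE => kE.
have := congr1 (pairing^~ (a1 x)) kE; have := congr1 (pairing^~ (a2 x)) kE.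
rewrite !pairing_comb !pairingZl.
have [-> -> _ _ _] := hE_pairing Up.
have [-> -> _ _ _] := acf_e1 acf Ux; have [-> -> _ _ _] := acf_e2 acf Ux.
rewrite !mulr0 !mulr1 add0r addr0 => -> /= ak.
by rewrite -ak mulrAC divff // mul1r.
Qed.

(** [lie_ell] already splits the bracket along the plane and [dd]. The two are independent because
    the base components of [l1] and [l2] are, so the projection to [V] keeps exactly the [dd]
    term. *)
Lemma quarticE VV Q p : U' p -> VV p = <[dd p]>%VS -> Q p = <<[:: l1 p; l2 p]>>%VS ->
  quartic e1 e2 f1 f2 VV Q p = - 'D_(l1 p) aA2 p + 'D_(l2 p) aA1 p
    - e1_S e1 e2 f1 f2 p * f1_S e1 e2 f1 f2 p - e2_S e1 e2 f1 f2 p * f2_S e1 e2 f1 f2 p.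
Proof.
move=> Up VE QE; rewrite /quartic /fundamental_tensor VE QE (lie_ell Up) -scaleNr.
set q := _ *: l1 p + _ *: l2 p; set k := _ + _ * _.
have qQ : q \in <<[:: l1 p; l2 p]>>%VS by apply/mem_span2; do 2!eexists.
have dis : (<[dd p]> :&: <<[:: l1 p; l2 p]>> = 0)%VS.
  apply/eqP; rewrite -subv0; apply/subvP => w /memv_capP[/vlineP[a ->]].
  move=> /mem_span2[x [y]]; rewrite ell_comb scale_ddt => -[xy ->].
  have [] := hEF_coord x y Up; rewrite -xy !pairing0l => <- /eqP.
  by rewrite eq_sym oppr_eq0 => /eqP ->; rewrite !mul0r addr0 memv0.
(* The complementary projection fixes [q], and the two projections add up to the identity on the
   sum. *)
have q0 : daddv_pi <[dd p]> <<[:: l1 p; l2 p]>> q = 0.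
  have dis' : (<<[:: l1 p; l2 p]>> :&: <[dd p]> = 0)%VS by rewrite capvC.
  have qD : q \in (<[dd p]> + <<[:: l1 p; l2 p]>>)%VS.
    by apply: (subvP (addvSr _ _)).
  have := daddv_pi_add dis qD; rewrite (daddv_pi_id dis' qQ) => /eqP.
  by rewrite -subr_eq0 addrK => /eqP.
rewrite linearD /= q0 add0r daddv_pi_id // ?memvZ ?memv_line // scale_ddt /dt /= /k.
move: ('D_(l1 p) aA2 p) ('D_(l2 p) aA1 p) => D1 D2.
move: (e1_S _ _ _ _ p) (e2_S _ _ _ _ p) (f1_S _ _ _ _ p) (f2_S _ _ _ _ p) => k1 k2 k3 k4.
ring.
Qed.

(** Splitting [l1] and [l2] into horizontal and vertical parts isolates the degrees: horizontal
    derivatives of a cubic stay cubic and gain at most one factor [t], products of two components of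
    S are quartic, and the vertical parts form the Wronskian of two cubics. *)
Lemma quartic_horner x : U x -> exists2 q : {poly K}, (size q <= 5)%N &
  forall t, - 'D_(l1 (x, t)) aA2 (x, t) + 'D_(l2 (x, t)) aA1 (x, t)
    - e1_S e1 e2 f1 f2 (x, t) * f1_S e1 e2 f1 f2 (x, t)
    - e2_S e1 e2 f1 f2 (x, t) * f2_S e1 e2 f1 f2 (x, t) = q.[t].
Proof.
move=> Ux.
have [[P1 sP1 P1E] D1] := fibre_poly_horner oU Ux A1_poly.
have [[P2 sP2 P2E] D2] := fibre_poly_horner oU Ux A2_poly.
have [s1 s2 s3 s4] := coframe_S_poly.
have [[R1 sR1 R1E] _] := fibre_poly_horner oU Ux s1.
have [[R2 sR2 R2E] _] := fibre_poly_horner oU Ux s2.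
have [[R3 sR3 R3E] _] := fibre_poly_horner oU Ux s3.
have [[R4 sR4 R4E] _] := fibre_poly_horner oU Ux s4.
have [Q1 sQ1 Q1E] := D2 (e1 x); have [Q2 sQ2 Q2E] := D2 (e2 x).
have [Q3 sQ3 Q3E] := D1 (f1 x); have [Q4 sQ4 Q4E] := D1 (f2 x).
have sX (r : {poly K}) : (size r <= 4)%N -> (size ('X * r)%R <= 5)%N.
  move=> sr; apply: leq_trans (size_polyMleq _ _) _.
  by rewrite size_polyX.
have sM (r s : {poly K}) : (size r <= 3)%N -> (size s <= 3)%N -> (size (r * s)%R <= 5)%N.
  by move=> sr ss; apply: leq_trans (size_polyMleq _ _) _; lia.
have sD (r s : {poly K}) : (size r <= 5)%N -> (size s <= 5)%N -> (size (r + s)%R <= 5)%N.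
  by move=> sr ss; apply: leq_trans (size_polyD _ _) _; rewrite geq_max sr.
have sN (r : {poly K}) : (size r <= 5)%N -> (size (- r)%R <= 5)%N by rewrite size_polyN.
(* [Q1], [Q2] come from [A2] differentiated along [e1], [e2], and [Q3], [Q4] from [A1] along [f1],
   [f2]. Size 5 means degree at most 4, the bound of [size_wronskian] at [d = 3]. *)
exists (- (Q1 + 'X * Q2) + ('X * Q3 - Q4) + (deriv P1 * P2 - P1 * deriv P2)
  - R1 * R3 - R2 * R4).
  apply: (sD); [|by apply: sN; exact: sM].
  apply: (sD); [|by apply: sN; exact: sM].
  apply: (sD); [|exact: (size_wronskian (d := 3))].
  apply: (sD); first by apply: (sN); apply: (sD); [exact: leqW|exact: sX].
  by apply: (sD); [exact: sX|apply: (sN); exact: leqW].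
move=> t; have Up : U' (x, t) by [].
have dA1 := holomorphic_differentiable holomorphic_A1 Up.
have dA2 := holomorphic_differentiable holomorphic_A2 Up.
have decE : l1 (x, t) = (e1 x, 0) + t *: (e2 x, 0) + aA1 (x, t) *: (0, 1).
  rewrite ell1E [RHS]surjective_pairing /= !scaler0 !addr0 add0r.
  by congr (_, _); exact: esym (mulr1 _).
have decF : l2 (x, t) = t *: (f1 x, 0) - (f2 x, 0) + aA2 (x, t) *: (0, 1).
  rewrite ell2E [RHS]surjective_pairing /= !scaler0 addr0 subr0 add0r.
  by congr (_, _); exact: esym (mulr1 _).
rewrite decE decF.
rewrite !(deriveDdir _ _ dA1, deriveDdir _ _ dA2, deriveZdir _ _ dA1, deriveZdir _ _ dA2,
  deriveNdir _ dA1).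
have [P1t P1d] := P1E t; have [P2t P2d] := P2E t.
have [R1t _] := R1E t; have [R2t _] := R2E t; have [R3t _] := R3E t; have [R4t _] := R4E t.
rewrite P1d P2d P1t P2t R1t R2t R3t R4t Q1E Q2E Q3E Q4E.
rewrite !(hornerD, hornerN, hornerM, hornerX).
rewrite -![_ *: _]/(_ * _).
move: (P1.[t]) (P2.[t]) (Q1.[t]) (Q2.[t]) (Q3.[t]) (Q4.[t]) (R1.[t]) (R2.[t]) (R3.[t])
  (R4.[t]) ((deriv P1).[t]) ((deriv P2).[t]) => k1 k2 k3 k4 k5 k6 k7 k8 k9 k10 k11 k12.
ring.
Qed.

End LiftFrame.

(** * From the atlas to one chart, and the theorem *)

Section Charts.
Context {K : numFieldType} {n : nat} (N : manifold K n).

Lemma open_chart_img (i : chart_index N) : open (chart_img i).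
Proof. by case: N i => ? ? ? ? ? ? ? ? ? oi ? ? ? i; exact: oi. Qed.

Lemma holomorphic_vector_field (X : vector_field N) i : holomorphic (chart_img i) (X i).
Proof. by case: X => X hX cX; exact: hX. Qed.

End Charts.

Lemma LC_contact (K : numFieldType) (N : manifold K 5) (S : LC_structure N) i :
  is_contact (chart_img i) (LC_C S i).
Proof. by case: S => E F C hC hE hF; exact: hC. Qed.

Lemma dim_contact (K : numFieldType) n (U : set 'rV[K]_n) C x :
  is_contact U C -> U x -> \dim (C x) = n.-1.
Proof.
move=> [dC _] /dC[W [X [_ Wx _ _ /(_ x Wx) XB]]].
rewrite (size_basis XB) dimvf; exact: (congr1 predn (mul1n n)).
Qed.

(** The canonical fields are characterized and not constructed, so they are both exhibited and
    identified. [quartic] depends on [V] and [Q] alone, and these are unique, so the ambiguity in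
    the order of [L1] and [L2] does not reach the formula. *)
Theorem lemma2p6 (R : realType) (N : manifold (CC R) 5) (LC : LC_structure N)
    (e1 e2 f1 f2 : vector_field N) (he : LC_adapted LC e1 e2 f1 f2)
    (i : chart_index N) :
  let U := chart_img i in
  let E := LC_E LC i in
  let F := LC_F LC i in
  let LE := line_E (e1 i) (e2 i) in
  let LF := line_F (f1 i) (f2 i) in
  let D := lift_D (e1 i) (e2 i) (f1 i) (f2 i) in
  let D2 := lift_D2 E F in
  let a1 := A1 (e1 i) (e2 i) (f1 i) (f2 i) in
  let a2 := A2 (e1 i) (e2 i) (f1 i) (f2 i) in
  let l1 := ell1 (e1 i) (e2 i) (f1 i) (f2 i) in
  let l2 := ell2 (e1 i) (e2 i) (f1 i) (f2 i) in
  let e1S := e1_S (e1 i) (e2 i) (f1 i) (f2 i) in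
  let e2S := e2_S (e1 i) (e2 i) (f1 i) (f2 i) in
  let f1S := f1_S (e1 i) (e2 i) (f1 i) (f2 i) in
  let f2S := f2_S (e1 i) (e2 i) (f1 i) (f2 i) in
  let Q4 := quartic (e1 i) (e2 i) (f1 i) (f2 i) in
  [/\ forall x, U x ->
        (forall t, lift_fibre U E F x (LE (x, t)) (LF (x, t))) /\
        (forall lE lF, lift_fibre U E F x lE lF -> lE <> <[e2 i x]>%VS ->
           exists! t, lE = LE (x, t) /\ lF = LF (x, t)),
      forall p, lift_dom U p ->
        D p = <<[:: field_E (e1 i) (e2 i) p; field_F (f1 i) (f2 i) p; ddt p]>>%VS,
      exists Q, canonical_fields (lift_dom U) D D2
        (fun p => <[ddt p]>%VS) Q (fun p => <[l1 p]>%VS) (fun p => <[l2 p]>%VS) &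
      forall V Q L1 L2, canonical_fields (lift_dom U) D D2 V Q L1 L2 ->
        [/\ forall p, lift_dom U p ->
              V p = <[ddt p]>%VS /\
              ((L1 p = <[l1 p]>%VS /\ L2 p = <[l2 p]>%VS) \/
               (L1 p = <[l2 p]>%VS /\ L2 p = <[l1 p]>%VS)),
            forall p, lift_dom U p ->
              Q4 V Q p = - 'D_(l1 p) a2 p + 'D_(l2 p) a1 p
                         - e1S p * f1S p - e2S p * f2S p &
            forall x, U x -> exists P : {poly CC R}, (size P <= 5)%N /\
              forall t, Q4 V Q (x, t) = P.[t]]].
Proof.
move=> U E F LE LF D D2 a1 a2 l1 l2 e1S e2S f1S f2S Q4.
have oU : open U by exact: open_chart_img.
have had : forall x, U x -> let C := (E x + F x)%VS in
    [/\ E x = <<[:: e1 i x; e2 i x]>>%VS /\ F x = <<[:: f1 i x; f2 i x]>>%VS,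
        lie (e1 i) (e2 i) x \in C /\ lie (f1 i) (f2 i) x \in C,
        lie (e1 i) (f2 i) x \in C /\ lie (e2 i) (f1 i) x \in C,
        lie (e1 i) (f1 i) x - lie (e2 i) (f2 i) x \in C &
        lie (e1 i) (f1 i) x \notin C] by move=> x Ux; exact: (he i x Ux).
have [c1 [c2 [d1 [d2 [th acf]]]]] := exists_adapted_coframe oU
  (@holomorphic_vector_field _ _ _ e1 i) (@holomorphic_vector_field _ _ _ e2 i)
  (@holomorphic_vector_field _ _ _ f1 i) (@holomorphic_vector_field _ _ _ f2 i) had
  (fun x Ux => dim_contact (@LC_contact _ _ LC i) Ux).
split.
- move=> x Ux; split=> [t|lE lF]; first exact: (lift_fibre_line acf).
  exact: (lift_fibre_chart acf).
- by move=> p _; exact: lift_DE.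
- exists (fun p => <<[:: l1 p; l2 p]>>%VS); exact: (canonical_fields_ell acf).
move=> V Q L1 L2 can; split=> [p Up|p Up|x Ux].
- by have [] := canonical_fields_unique acf can Up.
- by have [VE QE _] := canonical_fields_unique acf can Up; exact: (quarticE acf Up VE QE).
have [q sq qE] := quartic_horner acf Ux; exists q; split=> // t.
have Up : lift_dom U (x, t) by [].
have [VE QE _] := canonical_fields_unique acf can Up.
by rewrite -qE; exact: (quarticE acf Up VE QE).
Qed.
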